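(* Let $w$ be an even positive integer. Then $$\{\,E_{w,4i\pm1}\ |\ i=1,2,\ldots,d_w\,\}\cup\{F_w\}\cup\{G_w\}$$ form a basis for the complex vector space $\mathcal E_w^+$.
   Context: $\mathbb Z^+$ is the set of positive integers. A function $E:\mathbb Z^+\times\mathbb Z\to\mathbb C$ is a (weighted) Dedekind symbol of weight $w$ if $E(h,k)=E(h,k+h)$ and $E(ch,ck)=c^wE(h,k)$ for all $(h,k)\in\mathbb Z^+\times\mathbb Z$ and $c\in\mathbb Z^+$. It is even if $E(h,-k)=E(h,k)$. $\mathcal E_w$ is the space of Dedekind symbols $E$ of weight $w$ for which $E(h,k)-E(k,-h)$, as a function of $(h,k)\in\mathbb Z^+\times\mathbb Z^+$, is a homogeneous polynomial in $h$ and $k$ of degree $w$ (complex coefficients, zero allowed); $\mathcal E_w^+$ is the subspace of even symbols in $\mathcal E_w$. $G_w(h,k)=\{\gcd(h,k)\}^w$ and $F_w(h,k)=h^w$. The integer $d_w$ is defined by $d_w=\lfloor\frac{w+2}{12}\rfloor-1$ if $w\equiv 0\pmod{12}$ and $d_w=\lfloor\frac{w+2}{12}\rfloor$ otherwise. Convention: for $1\le i\le d_w$, the symbol $4i\pm1$ means $4i+1$ if $w\equiv0\pmod4$, and $4i-1$ if $w\equiv2\pmod 4$. $B_m(x)$ is the $m$th Bernoulli polynomial, $\frac{te^{xt}}{e^t-1}=\sum_{m\ge0}B_m(x)\frac{t^m}{m!}$; $B_m=B_m(0)$; $\bar B_m(x)$ is the function of period $1$ coinciding with $B_m(x)$ on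 $[0,1)$; $\mathrm{sgn}(x)$ is the sign of $x\in\mathbb R$; $\Gamma=SL_2(\mathbb Z)$. For an integer $n$ with $0<n<w$ put $\tilde n=w-n$ and, for $(h,k)\in\mathbb Z^+\times\mathbb Z$, $$E_{w,n}(h,k)=\frac12\sum_{\substack{\left[\begin{smallmatrix}a&b\\c&d\end{smallmatrix}\right]\in\Gamma\\ ac\neq0\\ (k/h+b/a)(k/h+d/c)<0}}\mathrm{sgn}\Big(\frac kh+\frac ba\Big)(ak+bh)^{\tilde n}(ck+dh)^n+\Big\{(-1)^n\frac{\bar B_{n+1}(\frac kh)h^w}{n+1}-\frac{\bar B_{\tilde n+1}(\frac kh)h^w}{\tilde n+1}\Big\}+\delta_n h^w,$$ where $\delta_n=\frac{w+2}{B_{w+2}}\frac{B_{n+1}}{n+1}\frac{B_{\tilde n+1}}{\tilde n+1}$ if $n$ is odd and $\delta_n=0$ if $n$ is even (the sum is finite). *)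

(* Defs.v *)
From HB Require Import structures.
From mathcomp Require Import all_boot all_order all_algebra mpoly.
From mathcomp Require Import boolp classical_sets functions cardinality fsbigop.
From mathcomp Require Import reals interval_inference complex.
From mathcomp Require Import zify ring.

Set Implicit Arguments.
Unset Strict Implicit.
Unset Printing Implicit Defensive.

Import Order.TTheory GRing.Theory Num.Theory.
Local Open Scope classical_set_scope.
Local Open Scope ring_scope.

(* S is the span of X. Freeness is stated for sequences, so the members of X
   are also distinct. *)
Definition is_basis (K : fieldType) (V : lmodType K) (S : set V) (X : seq V) :=
  (forall c : 'I_(size X) -> K,
     \sum_i c i *: X`_i = 0 -> forall i, c i = 0) /\
  (forall v, S v <->
     exists c : 'I_(size X) -> K, v = \sum_i c i *: X`_i).

Section Bernoulli.
Variable F : numFieldType.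

(* For m < size (bernoulli_seq n) = n, entry m is B_m. The recursion is the
   coefficient of t^(n+1) in (e^t - 1) * \sum_m B_m(x) t^m / m! = t e^(xt); see
   bernpolyP. *)
Fixpoint bernoulli_seq (n : nat) : seq {poly F} :=
  if n is m.+1 then
    let s := bernoulli_seq m in
    rcons s ('X^m - m.+1%:R^-1 *: \sum_(j < m) s`_j *+ 'C(m.+1, j))
  else [::].

Definition bernpoly (m : nat) : {poly F} := (bernoulli_seq m.+1)`_m.

Definition bernnum (m : nat) : F := (bernpoly m).[0].

Definition expm1_coef (n : nat) : F := if n is 0%N then 0 else n`!%:R^-1.

Definition texp_coef (n : nat) : {poly F} :=
  if n is m.+1 then m`!%:R^-1 *: 'X^m else 0.

Lemma size_bernoulli_seq n : size (bernoulli_seq n) = n.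
Proof. by elim: n => //= n IHn; rewrite size_rcons IHn. Qed.

Lemma nth_bernoulli_seq n j : (j < n)%N -> (bernoulli_seq n)`_j = bernpoly j.
Proof.
elim: n => // n IHn; rewrite ltnS leq_eqVlt => /predU1P[-> //|ltjn].
by rewrite /= nth_rcons size_bernoulli_seq ltjn IHn.
Qed.

Lemma bernpolyE n : bernpoly n =
  'X^n - n.+1%:R^-1 *: \sum_(j < n) bernpoly j *+ 'C(n.+1, j).
Proof.
rewrite {1}/bernpoly /= nth_rcons size_bernoulli_seq ltnn eqxx.
congr (_ - _ *: _); apply: eq_bigr => j _.
by rewrite nth_bernoulli_seq.
Qed.

(* The Bernoulli polynomials are the unique sequence with
   (e^t - 1) * \sum_m B_m(x) t^m / m! = t e^(xt) as formal power series in t. *)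
Lemma bernpolyP (B : nat -> {poly F}) :
  (forall n, \sum_(j < n.+1) (j`!%:R^-1 * expm1_coef (n - j)) *: B j
             = texp_coef n)
  <-> B =1 bernpoly.
Proof.
have cE n j : (j <= n)%N ->
    (n.+1)`!%:R * (j`!%:R^-1 * expm1_coef (n.+1 - j)) = 'C(n.+1, j)%:R.
  move=> lejn; have lejn1 : (j <= n.+1)%N := leqW lejn.
  rewrite subSn //= -subSn // -(bin_fact lejn1) !natrM.
  by rewrite -invfM mulfK // mulf_neq0 // pnatr_eq0 -lt0n fact_gt0.
have factN0 m : m`!%:R != 0 :> F by rewrite pnatr_eq0 -lt0n fact_gt0.
have step (C : nat -> {poly F}) n :
    \sum_(j < n.+2) (j`!%:R^-1 * expm1_coef (n.+1 - j)) *: C j = texp_coef n.+1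
    <-> C n = 'X^n - n.+1%:R^-1 *: \sum_(j < n) C j *+ 'C(n.+1, j).
  have -> : \sum_(j < n.+2) (j`!%:R^-1 * expm1_coef (n.+1 - j)) *: C j
      = (n.+1)`!%:R^-1 *: (\sum_(j < n) C j *+ 'C(n.+1, j) + n.+1%:R *: C n).
    rewrite big_ord_recr /= subnn mulr0 scale0r addr0 big_ord_recr /=.
    rewrite scalerDr scaler_sumr; congr (_ + _).
      apply: eq_bigr => j _; rewrite -scaler_nat scalerA; congr (_ *: _).
      by rewrite -(cE n j (ltnW (ltn_ord j))) (mulKf (factN0 _)).
    rewrite scalerA; congr (_ *: _).
    have -> : n.+1%:R = 'C(n.+1, n)%:R :> F by rewrite binSn.
    by rewrite -(cE n n (leqnn n)) (mulKf (factN0 _)).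
  have -> : texp_coef n.+1 = (n.+1)`!%:R^-1 *: (n.+1%:R *: 'X^n) :> {poly F}.
    by rewrite /= scalerA factS natrM invfM mulrAC mulVf ?mul1r.
  have n1 : n.+1%:R != 0 :> F by rewrite pnatr_eq0.
  split=> [/(scalerI (invr_neq0 (factN0 _))) E|->].
    apply: (scalerI n1); rewrite scalerBr -E scalerA mulfV // scale1r.
    by rewrite addrC addKr.
  by rewrite scalerBr scalerA mulfV // scale1r addrC subrK.
split=> [E|EB].
  move=> n; elim/ltn_ind: n => n IHn; rewrite (step B n).1 // bernpolyE.
  by congr (_ - _ *: _); apply: eq_bigr => j _; rewrite IHn.
case=> [|n]; first by rewrite big_ord_recr big_ord0 /= mulr0 scale0r addr0.
apply/step; rewrite EB bernpolyE.
by congr (_ - _ *: _); apply: eq_bigr => j _; rewrite EB.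
Qed.

End Bernoulli.

Notation symbol R := ({posnum int} * int -> (R[i])^o).

Section DedekindSymbols.
Variable R : realType.
Implicit Types (w n : nat) (E : symbol R) (h : {posnum int}) (k : int).

Definition bernper (m : nat) (x : R) : R :=
  (bernpoly R m).[x - (Num.floor x)%:~R].

Definition dedekind_symbol w E :=
  (forall h k, E (h, k) = E (h, k + h%:num)) /\
  (forall (c h : {posnum int}) k,
     E ((c%:num * h%:num)%:pos, c%:num * k) = c%:num%:~R ^+ w * E (h, k)).

Definition even_symbol E := forall h k, E (h, - k) = E (h, k).

Definition pair2 (x y : R[i]) (i : 'I_2) : R[i] := if i == ord0 then x else y.

Definition polynomial_reciprocity w E :=
  exists2 p : {mpoly R[i][2]},
    p \is w.-homog &
    forall h (k : {posnum int}),
      E (h, k%:num) - E (k, - h%:num)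
      = p.@[pair2 h%:num%:~R k%:num%:~R].

Definition dedekind_space w : set (symbol R) :=
  [set E | dedekind_symbol w E /\ polynomial_reciprocity w E].

Definition even_dedekind_space w : set (symbol R) :=
  [set E | dedekind_space w E /\ even_symbol E].

Definition symbG w : symbol R := fun hk => (gcdz hk.1%:num hk.2)%:~R ^+ w.

Definition symbF w : symbol R := fun hk => hk.1%:num%:~R ^+ w.

Definition dimd w : nat :=
  if (12 %| w)%N then ((w + 2) %/ 12 - 1)%N else ((w + 2) %/ 12)%N.

Definition index4pm1 w (i : nat) : nat :=
  if (4 %| w)%N then (4 * i + 1)%N else (4 * i - 1)%N.

Section Ewn.
Variables (w n : nat) (h : {posnum int}) (k : int).
Let n' := (w - n)%N.
Let x : R := k%:~R / h%:num%:~R.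

(* g = [a b; c d], i.e. a = g 0 0, b = g 0 1, c = g 1 0, d = g 1 1. *)
Definition Gamma_range : set 'M[int]_2 :=
  [set g | [/\ \det g = 1, g 0 0 * g 1 0 != 0 &
     (x + (g 0 1)%:~R / (g 0 0)%:~R) * (x + (g 1 1)%:~R / (g 1 0)%:~R) < 0]].

(* By this, \sum_(g \in Gamma_range) is never the value 0 which \sum_(g \in A)
   takes by convention on an infinite support. *)
Lemma finite_Gamma_range : finite_set Gamma_range.
Proof.
have shiftK (z : int) (m : nat) : `|z| <= m%:Z ->
    (inord (absz (z + m%:Z)) : 'I_(m + m).+1)%:Z - m%:Z = z.
  rewrite ler_norml => /andP[z1 z2].
  have z0 : 0 <= z + m%:Z by rewrite -lerBlDr sub0r.
  rewrite inordK; first by rewrite gez0_abs // addrK.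
  by rewrite ltnS -lez_nat gez0_abs // PoszD lerD2r.
set H : int := h%:num; have H0 : 0 < H by rewrite /H gt0.
pose M : nat := absz (H * (1 + `|k|)).
have ME : M%:Z = H * (1 + `|k|).
  by rewrite /M abszE ger0_norm // mulr_ge0 ?ltW // addr_ge0.
pose f (g : 'M['I_(M + M).+1]_2) : 'M[int]_2 :=
    map_mx (fun i : 'I_(M + M).+1 => (i : nat)%:Z - M%:Z) g.
apply: (@sub_finite_set _ _ (f @` setT)); last exact/finite_image/finite_finset.
move=> g; rewrite /Gamma_range /=.
have -> : \det g = g 0 0 * g 1 1 - g 0 1 * g 1 0.
  rewrite (expand_det_row _ 0) big_ord_recl big_ord1 /cofactor !det_mx11 !mxE.
  rewrite !(mul1r, expr0) /= expr1 mulN1r mulrN.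
  by congr (_ * g _ _ - g _ _ * g _ _); apply: val_inj.
set a := g 0 0; set b := g 0 1; set c := g 1 0; set d := g 1 1.
case=> det1; rewrite mulf_eq0 negb_or => /andP[a0 c0] neg.
pose p := a * k + b * H; pose q := c * k + d * H.
have pcqa : p * c - q * a = - H by rewrite /p /q -[in RHS](mul1r H) -det1; ring.
have pqac : (p * c) * (q * a) < 0.
  have aR : a%:~R != 0 :> R by rewrite intr_eq0.
  have cR : c%:~R != 0 :> R by rewrite intr_eq0.
  have HR : H%:~R != 0 :> R by rewrite intr_eq0 gt_eqF.
  have E : ((p * c) * (q * a))%:~R =
      (x + b%:~R / a%:~R) * (x + d%:~R / c%:~R)
      * (H%:~R * a%:~R * c%:~R) ^+ 2 :> R.
    rewrite /p /q /x -/H !(intrM, intrD); field.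
    by rewrite aR cR HR.
  rewrite -(ltr_int R) E pmulr_llt0 // exprn_even_gt0 //=.
  by rewrite !mulf_neq0.
have [pcH qaH] : `|p * c| <= H /\ `|q * a| <= H.
  have qaE : q * a = p * c + H by rewrite -[H]opprK -pcqa; ring.
  move: pqac; rewrite qaE; move: (p * c) => X XH.
  have X0 : X < 0.
    case: (ltrP X 0) => // X0; move: XH.
    by rewrite ltNge mulr_ge0 // addr_ge0 // ltW.
  have Y0 : 0 < X + H by rewrite -(nmulr_rlt0 _ X0).
  by rewrite ltr0_norm // gtr0_norm //; lia.
have le_norm (y z : int) : y * z != 0 -> `|y * z| <= H -> `|y| <= H /\ `|z| <= H.
  rewrite mulf_eq0 negb_or -!normr_gt0 normrM => /andP[y0 z0] yz.
  split; apply: le_trans yz; [rewrite ler_peMr|rewrite ler_peMl] => //; lia.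
have [pc0 qa0] : p * c != 0 /\ q * a != 0.
  by apply/andP; rewrite -negb_or -mulf_eq0 lt_eqF.
have [pH cH] := le_norm _ _ pc0 pcH; have [qH aH] := le_norm _ _ qa0 qaH.
have le_bd (u v r : int) : r = u * k + v * H -> `|r| <= H -> `|u| <= H ->
    `|v| <= M%:Z.
  move=> rE rH uH; rewrite ME; have vH : v * H = r - u * k by rewrite rE; ring.
  have : `|v * H| <= H * (1 + `|k|).
    rewrite vH (le_trans (ler_normB _ _)) // normrM mulrDr mulr1 lerD //.
    by rewrite ler_wpM2r.
  by rewrite normrM (gtr0_norm H0); apply: le_trans; rewrite ler_peMr.
have bM := le_bd a b p erefl pH aH; have dM := le_bd c d q erefl qH cH.
have HM : H <= M%:Z by rewrite ME (ler_peMr (ltW H0)) // lerDl.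
have gM i j : `|g i j| <= M%:Z.
  have I2 (l : 'I_2) : l = 0 \/ l = 1.
    by case: l => [[|[|//]]] l2; [left|right]; apply: val_inj.
  by have [->|->] := I2 i; have [->|->] := I2 j; rewrite // (le_trans _ HM).
exists (\matrix_(i, j) inord (absz (g i j + M%:Z))) => //.
by apply/matrixP => i j; rewrite !mxE; apply: shiftK.
Qed.

Definition Gamma_term (g : 'M[int]_2) : R :=
  Num.sg (x + (g 0 1)%:~R / (g 0 0)%:~R)
  * (g 0 0 * k + g 0 1 * h%:num)%:~R ^+ n'
  * (g 1 0 * k + g 1 1 * h%:num)%:~R ^+ n.

Definition delta_wn : R :=
  if odd n then
    w.+2%:R / bernnum R w.+2 * (bernnum R n.+1 / n.+1%:R)
      * (bernnum R n'.+1 / n'.+1%:R)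
  else 0.

Definition Ewn_real : R :=
  2^-1 * \sum_(g \in Gamma_range) Gamma_term g
  + ((-1) ^+ n * (bernper n.+1 x * h%:num%:~R ^+ w / n.+1%:R)
     - bernper n'.+1 x * h%:num%:~R ^+ w / n'.+1%:R)
  + delta_wn * h%:num%:~R ^+ w.

End Ewn.

Definition symbE w n : symbol R := fun hk => (Ewn_real w n hk.1 hk.2)%:C%C.

End DedekindSymbols.

Arguments is_basis K V S X : clear implicits.
Arguments even_dedekind_space R w : clear implicits.
Arguments symbE R w n : clear implicits.
Arguments symbF R w : clear implicits.
Arguments symbG R w : clear implicits.

(* Main.v *)
Require Import Defs.
From mathcomp Require Import all_boot all_order all_algebra mpoly.
From mathcomp Require Import boolp classical_sets functions cardinality fsbigop.
From mathcomp Require Import reals interval_inference complex polyrcf.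
From mathcomp Require Import zify ring lra.

(** Write w = 2m. Attach to an even symbol E its reciprocity polynomial, the form
    E(h,k) - E(k,-h). If it vanishes, the Euclidean algorithm shows that E is a
    multiple of G_w ([symbG_unique]). In general it is an antisymmetric form f with
    f(a+b,b) + f(a,a+b) = f(a,b) ([even_period_of_symbol]), and such forms make up
    a space of dimension at most ceil(m/2) - floor(m/3) = d_w + 1: their
    coefficients are killed by a matrix whose rank is bounded below by exhibiting
    alternating forms in its row space ([alt_form_mx_sub], [even_period_span]).
    So the theorem reduces to the linear independence of the reciprocity
    polynomials of F_w and of the d_w symbols E_{w,n}.

    These polynomials are explicit. The sums over SL2(Z) in E_{w,n} at (h,k) and
    at (k,-h) cancel matrix by matrix, except for matrices with a zero entry
    ([crossing_cancel]). What is left are sums of powers, that is, values of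
    Bernoulli polynomials, and with
      b_n(x) = B_{n+1}(x) / (n+1) + B_{w-n+1}(x) / (w-n+1)
    the reciprocity polynomial of E_{w,n} is k^w b_n(h/k) - h^w b_n(k/h) plus a
    multiple of h^w - k^w, which is that of F_w ([Ewn_real_reciprocity]).

    For independence, suppose that a combination of these polynomials vanishes.
    Then for suitable constants p = sum_n c_n b_n - e satisfies x^w p(1/x) = p(x);
    also p(1-x) = p(x), as n is odd, and
      p(x) - p(-x) = - sum_n c_n (x^n + x^(w-n))
    has at most 2 d_w monomials. The two symmetries generate the anharmonic group
    of order six, so p is a combination of products of powers of
    Q = 1 - x + x^2 and C^2 = x^2 (1-x)^2 ([anharmonic_invariant]). Since
    Q = x (u - 1) and C^2 = x^3 (u - 2) with u = x + 1/x, this reads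
    p(x) = x^m q(u) for a polynomial q, and q has many more roots in the right
    half-plane than elsewhere, because a cubic (u-1)^3 - l (u-2) never has more
    than one root outside it ([cubic_right_roots]). On the imaginary axis u is
    imaginary too, and the argument of q(u) turns many times. So p(x) - p(-x),
    which is there 2 i times the imaginary part of p(x), has many zeros x = i y
    with y > 0 ([many_real_roots]): more than the 2 d_w - 1 positive zeros y which
    Descartes' rule allows to a real polynomial with 2 d_w monomials. This
    contradiction is the content of [anharmonic_odd_part_free].

    The turning of the argument is treated algebraically. If all roots of A lie
    in the upper half-plane, a polynomial G A + conj(G A) with
    deg G <= deg A - 2, divided by |A|^2, has integral zero over the real line,
    so it cannot be a nonzero square |K|^2; and a real polynomial with few real
    roots of odd multiplicity becomes such a square, up to a real factor, after
    multiplication by a polynomial of small degree. *)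

Set Implicit Arguments.
Unset Strict Implicit.
Unset Printing Implicit Defensive.

Import Order.TTheory GRing.Theory Num.Theory.
Local Open Scope classical_set_scope.
Local Open Scope ring_scope.

(** * Polynomials with all roots in the upper half-plane *)

Section UpperHalfPlane.
Variable C : numClosedFieldType.
Implicit Types (K G X A : {poly C}) (s : seq C).

Local Notation conjp := (map_poly (@Num.conj C)).

Lemma conjpK : involutive conjp.
Proof.
by move=> p; apply/polyP => i; rewrite !coef_map /= conjCK.
Qed.

Lemma size_conjp p : size (conjp p) = size p.
Proof. exact: size_map_poly. Qed.

Lemma root_conjp p z : root (conjp p) z = root p z^*.
Proof. by rewrite !rootE -{1}[z]conjCK horner_map conjC_eq0. Qed.

Lemma prod_XsubC_upper_conj s a : (forall z, z \in s -> 0 < 'Im z) ->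
  0 < 'Im a -> (\prod_(z <- s) ('X - z%:P)).[a^*] != 0.
Proof.
move=> s_up a_up; rewrite -rootE root_prod_XsubC; apply/negP => /s_up.
by rewrite Im_conj oppr_gt0 => /(lt_trans a_up); rewrite ltxx.
Qed.

(** Partial fractions of |K|^2 / |A|^2, which on the real line is X / conj(A) plus
    its conjugate. The number c is, up to the factor 2 pi, the integral of
    |K|^2 / |A|^2 over the real line: X / conj(A) is holomorphic in the upper
    half-plane and its integral is read off its leading term i c / x. Hence
    c >= 0, with equality only for K = 0. The induction removes a root a of A,
    with K written as a multiple of A / (X - a) plus a multiple of X - conj(a). *)
Lemma norm_sqr_decomposition s K : (forall z, z \in s -> 0 < 'Im z) ->
  (size K <= size s)%N ->
  let A := \prod_(z <- s) ('X - z%:P) in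
  exists (X : {poly C}) (c : C), [/\ (size X <= size s)%N, 0 <= c,
    X`_(size s).-1 = 'i * c, K * conjp K = X * A + conjp (X * A)
    & c = 0 -> K = 0].
Proof.
elim: s K => [|a s IHs] K s_up leKs A.
  have -> : K = 0 by apply/eqP; rewrite -size_poly_leq0.
  exists 0, 0; split=> //; first by rewrite size_poly0.
    by rewrite coef0 mulr0.
  by rewrite rmorph0 !mul0r rmorph0 addr0.
have s_up' z : z \in s -> 0 < 'Im z by move=> zs; apply: s_up; rewrite inE zs orbT.
have a_up : 0 < 'Im a by apply: s_up; rewrite mem_head.
set A' : {poly C} := \prod_(z <- s) ('X - z%:P).
have AE : A = ('X - a%:P) * A' by rewrite /A big_cons.
have A'0 : A'.[a^*] != 0 by apply: prod_XsubC_upper_conj.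
have szA' : size A' = (size s).+1 by rewrite size_prod_XsubC.
have [k kE] : exists k, k * A'.[a^*] = K.[a^*].
  by exists (K.[a^*] / A'.[a^*]); rewrite divfK.
have /factor_theorem[K' K'E] : root (K - k *: A') a^*.
  by rewrite rootE !hornerE kE subrr.
have KE : K = k *: A' + K' * ('X - (a^*)%:P) by rewrite -K'E addrC subrK.
have leK's : (size K' <= size s)%N.
  have [->|K'0] := eqVneq K' 0; first by rewrite size_poly0.
  have : (size (K' * ('X - (a^*)%:P))%R <= (size s).+1)%N.
    rewrite -K'E (leq_trans (size_polyD _ _)) // geq_max leKs size_polyN.
    by rewrite (leq_trans (size_scale_leq _ _)) ?szA'.
  by rewrite size_Mmonic ?monicXsubC ?size_XsubC ?addn2.
have [X' [c' [leX' c'0 X'c K'K c'K]]] := IHs K' s_up' leK's.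
have ima : a^* - a = - ('i * 'Im a *+ 2).
  by rewrite {1 2}[a]Crect conjC_rect ?Creal_Re ?Creal_Im //; ring.
have aa0 : a^* - a != 0.
  by rewrite ima oppr_eq0 mulrn_eq0 mulf_neq0 ?neq0Ci ?gt_eqF.
(* The partial fraction k conj(k) / ((x - a) (x - conj(a))), with the
   imaginary residue t. *)
have [t [tE tN]] : exists t, k * k^* = t * (a^* - a) /\ t^* = - t.
  exists (k * k^* / (a^* - a)); split; first by rewrite divfK.
  rewrite fmorph_div rmorphM rmorphB /= !conjCK -[a - _]opprB invrN mulrN.
  by rewrite [k^* * k]mulrC.
pose X := X' * ('X - (a^*)%:P) + t *: conjp A'
  + k *: conjp K'.
exists X, (c' + `|k| ^+ 2 / ('Im a *+ 2)).
have kk0 : 0 <= `|k| ^+ 2 / ('Im a *+ 2).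
  by rewrite divr_ge0 ?exprn_ge0 // mulrn_wge0 // ltW.
split.
- rewrite /X /= (leq_trans (size_polyD _ _)) // geq_max; apply/andP; split.
    rewrite (leq_trans (size_polyD _ _)) // geq_max; apply/andP; split.
      have [->|X'0] := eqVneq X' 0; first by rewrite mul0r size_poly0.
      by rewrite size_Mmonic ?monicXsubC ?size_XsubC ?addn2.
    by rewrite (leq_trans (size_scale_leq _ _)) // size_conjp szA'.
  rewrite (leq_trans (size_scale_leq _ _)) // size_conjp.
  exact: leq_trans leK's _.
- exact: addr_ge0.
- rewrite /X /= !coefD !coefZ mulrBr coefB coefMX coefMC !coef_map /=.
  rewrite (nth_default _ leX') (nth_default _ leK's) mul0r rmorph0 mulr0 !addr0.
  have -> : A'`_(size s) = 1.
    have /monicP : A' \is monic by apply: monic_prod_XsubC.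
    by rewrite lead_coefE szA'.
  rewrite rmorph1 mulr1 subr0 mulrDr normCK.
  have -> : (if size s == 0%N then 0 else X'`_(size s).-1) = 'i * c'.
    case: (size s) leX' X'c => [|n] //= leX' <-.
    by rewrite nth_default.
  congr (_ + _); have -> : t = k * k^* / (a^* - a) by rewrite tE mulfK.
  rewrite ima.
  rewrite invrN mulrN -['i * 'Im a *+ 2]mulrnAr invfM invCi.
  by ring.
- have K'K2 : K' * conjp K' * ('X - a%:P) * ('X - (a^*)%:P) =
    X' * ('X - (a^*)%:P) * A + conjp (X' * ('X - (a^*)%:P) * A).
    rewrite K'K AE !rmorphM /= !rmorphB /= !map_polyX !map_polyC /= conjCK.
    by rewrite -/A'; ring.
  have A'E : (k * k^*) *: (A' * conjp A') =
      (t *: conjp A') * A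
      + conjp ((t *: conjp A') * A).
    rewrite AE !rmorphM /= !map_polyZ /= !conjpK !rmorphB /= !map_polyX.
    rewrite !map_polyC /= tN tE -!mul_polyC !(rmorphM, rmorphN, rmorphB) /=; ring.
  have -> : X * A = X' * ('X - (a^*)%:P) * A
      + (t *: conjp A') * A + (k *: conjp K') * A.
    by rewrite /X; ring.
  have addr6 (p1 p2 p3 q1 q2 q3 : {poly C}) :
    (p1 + p2 + p3) + (q1 + q2 + q3) = (p1 + q1) + (p2 + q2) + (p3 + q3) by ring.
  rewrite 2!rmorphD addr6 -K'K2 -A'E.
  rewrite KE AE !rmorphD /= !rmorphM /= !map_polyZ /= !conjpK !rmorphB /=.
  rewrite !map_polyX !map_polyC /= conjCK -!mul_polyC !rmorphM /=; ring.
move=> /eqP; rewrite paddr_eq0 // => /andP[/eqP/c'K K'0].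
rewrite mulf_eq0 invr_eq0 mulrn_eq0 (gt_eqF a_up) /= orbF expf_eq0 /= normr_eq0.
by move=> /eqP k0; rewrite KE k0 K'0 scale0r mul0r addr0.
Qed.

(** The degree of G leaves no leading term, so that the integral of |K|^2 / |A|^2
    over the real line is zero, hence K is. *)
Lemma norm_sqr_upper_half_plane s K G : (forall z, z \in s -> 0 < 'Im z) ->
  (size K <= size s)%N -> (size G <= (size s).-1)%N ->
  let A := \prod_(z <- s) ('X - z%:P) in
  K * conjp K = G * A + conjp (G * A) -> K = 0.
Proof.
move=> s_up leKs leGs A KG.
have [X [c [leX c0 Xc KX]]] := norm_sqr_decomposition s_up leKs.
apply; rewrite -/A in KX.
have szA : size A = (size s).+1 by rewrite size_prod_XsubC.
have leXG : (size (X - G)%R <= size s)%N.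
  rewrite (leq_trans (size_polyD _ _)) // geq_max leX size_polyN.
  by rewrite (leq_trans leGs) ?leq_pred.
have XGA : (X - G) * A = - (conjp (X - G) * conjp A).
  have : X * A + conjp (X * A) = G * A + conjp (G * A) by rewrite -KX -KG.
  rewrite !rmorphM /= rmorphB /= => H; apply/eqP; rewrite -subr_eq0; apply/eqP.
  have -> : (X - G) * A - - ((conjp X - conjp G) * conjp A) =
    (X * A + conjp X * conjp A) - (G * A + conjp G * conjp A) by ring.
  by rewrite H subrr.
(* X - G is now divisible by conj(A), whose degree is too large. *)
have cop : coprimep A (conjp A).
  rewrite coprimep_sym {2}/A big_seq.
  apply: (big_ind (fun q => coprimep (conjp A) q)).
  - exact: coprimep1.
  - by move=> p q; rewrite coprimepMr => -> ->.
  move=> z zs; rewrite coprimep_XsubC root_conjp rootE.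
  by apply: prod_XsubC_upper_conj => //; apply: s_up.
have : A %| conjp (X - G).
  by rewrite -(Gauss_dvdpl _ cop) -[_ * conjp A]opprK -XGA -mulNr dvdp_mull.
have [XG0 _|XG0 /dvdp_leq] := eqVneq (X - G) 0.
  have : X`_(size s).-1 = 0.
    by rewrite -(subrK G X) XG0 add0r nth_default.
  by rewrite Xc => /eqP; rewrite mulf_eq0 (negPf (neq0Ci _)) => /eqP.
rewrite map_poly_eq0 XG0 size_conjp szA => /(_ isT).
by move=> /leq_trans/(_ leXG); rewrite ltnn.
Qed.

(** A pair of conjugate roots or a double real root is already of the form
    K conj(K); multiplying by one more factor X - x for each real root x of odd
    multiplicity makes all real roots double. *)
Lemma real_poly_norm_sqr g : g != 0 -> conjp g = g ->
  exists (T : seq C) K (e : C), [/\ uniq T,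
    forall x, x \in T -> x \is Num.real /\ root g x, e != 0 /\ e \is Num.real
    & g * \prod_(x <- T) ('X - x%:P) = e *: (K * conjp K)].
Proof.
have [n] := ubnP (size g); elim: n g => // n IHn g /ltnSE-len g0 gR.
have conj_XsubC (z : C) : conjp ('X - z%:P) = 'X - (z^*)%:P.
  by rewrite rmorphB /= map_polyX map_polyC.
have conj_quot (d g' : {poly C}) : d != 0 -> conjp d = d -> conjp (g' * d) = g' * d ->
  conjp g' = g'.
  by move=> d0 dR; rewrite rmorphM /= dR; apply: mulIf.
have [/size_poly1P[e e0 gE]|/closed_rootP[z gz]] := boolP (size g == 1%N).
  exists [::], 1, e; rewrite big_nil gE rmorph1 !mulr1 alg_polyC; split=> //.
  split=> //; apply/CrealP; apply: (@polyC_inj C).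
  by move: gR; rewrite gE map_polyC.
have [zR|zNR] := boolP (z \is Num.real).
  have /factor_theorem[g' gE] := gz.
  have g'0 : g' != 0 by apply: contraNneq g0 => g'0; rewrite gE g'0 mul0r.
  have dR : conjp ('X - z%:P) = 'X - z%:P by rewrite conj_XsubC (CrealP zR).
  have g'R : conjp g' = g'.
    by apply: (conj_quot ('X - z%:P)); rewrite ?polyXsubC_eq0 // -gE.
  have ltg' : (size g' < n)%N.
    by move: len; rewrite gE size_Mmonic ?monicXsubC // size_XsubC addn2.
  have [T [K [e [uT Troot eR gT]]]] := IHn g' ltg' g'0 g'R.
  have [zT|zT] := boolP (z \in T).
    exists (rem z T), K, e; split=> //; first exact: rem_uniq.
      move=> x /mem_rem/Troot[xR rx]; split=> //; by rewrite gE rootM rx.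
    by rewrite -gT (perm_big _ (perm_to_rem zT)) big_cons gE mulrA.
  exists (z :: T), (K * ('X - z%:P)), e; split=> //; first by rewrite /= zT.
    move=> x; rewrite inE => /predU1P[->//|/Troot[xR rx]].
    by rewrite gE rootM rx.
  rewrite big_cons gE; transitivity (('X - z%:P) ^+ 2 * (g' * \prod_(x <- T) ('X - x%:P))).
    by ring.
  by rewrite gT rmorphM /= dR -!mul_polyC; ring.
have zz : z^* != z by apply: contra zNR => /eqP/CrealP.
have gzc : root g z^* by rewrite -root_conjp gR.
have /factor_theorem[g1 gE1] := gz.
have /factor_theorem[g' gE'] : root g1 z^*.
  by move: gzc; rewrite gE1 rootM root_XsubC (negPf zz) orbF.
have gE : g = g' * (('X - (z^*)%:P) * ('X - z%:P)) by rewrite gE1 gE' mulrA.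
have dR : conjp (('X - (z^*)%:P) * ('X - z%:P)) = ('X - (z^*)%:P) * ('X - z%:P).
  by rewrite rmorphM /= !conj_XsubC conjCK mulrC.
have g'0 : g' != 0 by apply: contraNneq g0 => g'0; rewrite gE g'0 mul0r.
have g'R : conjp g' = g'.
  apply: (conj_quot (('X - (z^*)%:P) * ('X - z%:P))) => //; last by rewrite -gE.
  by rewrite mulf_neq0 ?polyXsubC_eq0.
have ltg' : (size g' < n)%N.
  move: len; rewrite gE mulrA !size_Mmonic ?monicXsubC ?size_XsubC //.
    by rewrite !addn2 /=; apply: leq_trans.
  by rewrite mulf_neq0 ?polyXsubC_eq0.
have [T [K [e [uT Troot eR gT]]]] := IHn g' ltg' g'0 g'R.
exists T, (K * ('X - z%:P)), e; split=> //.
  by move=> x /Troot[xR rx]; rewrite gE rootM rx.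
rewrite gE mulrAC gT rmorphM /= conj_XsubC -!mul_polyC; ring.
Qed.
End UpperHalfPlane.

(** * The bound of Descartes on positive roots *)

Section Descartes.
Variable R : rcfType.
Implicit Types (p : {poly R}) (s : seq R).

Lemma rolle_path p x s : path <%R x s -> all (root p) (x :: s) ->
  exists s', [/\ size s' = size s, path <%R x s' & all (root p^`()) s'].
Proof.
elim: s x => [|y s IHs] x; first by exists [::].
move=> /= /andP[xy ys] /and3P[/rootP px /rootP py ps].
have [|s' [sz ys' ps']] := IHs y ys; first by rewrite /= ps andbT; apply/rootP.
have [|c] := @poly_rolle _ _ _ p xy; first by rewrite px py.
rewrite in_itv /= => /andP[xc cy] /rootP pc.
exists (c :: s'); split=> /=; rewrite ?sz ?xc ?pc //=.
by case: s' ys' {sz ps'} => //= z s' /andP[/(lt_trans cy)-> ->].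
Qed.

(** Descartes' rule with the number of monomials in place of the number of sign
    changes: dividing by X one may assume a nonzero constant term, and then the
    derivative has one monomial less and, by Rolle, at most one root less. *)
Lemma size_positive_roots p (e : seq nat) s : p != 0 ->
  (forall i, p`_i != 0 -> i \in e) ->
  uniq s -> (forall x, x \in s -> 0 < x /\ root p x) -> (size s < size e)%N.
Proof.
have [n] := ubnP (size p); elim: n p e s => // n IHn p e s /ltnSE-len p0 pe us sp.
(* The exponents of p / X, and also of the derivative of p. *)
pose e' := [seq i.-1 | i <- e & i != 0%N].
have mem_e' i : i.+1 \in e -> i \in e'.
  by move=> ie; apply/mapP; exists i.+1; rewrite // mem_filter.
have [p00|p00] := eqVneq p`_0 0.
  have /factor_theorem[q] : root p 0 by rewrite /root horner_coef0 p00.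
  rewrite subr0 => pE; have q0 : q != 0 by apply: contraNneq p0 => q0; rewrite pE q0 mul0r.
  have sz_e' : (size e' <= size e)%N by rewrite size_map size_filter count_size.
  apply: leq_trans sz_e'; apply: (IHn q) => //.
  - by move: len; rewrite pE size_mulX.
  - move=> i qi; apply/mem_e'/pe; by rewrite pE coefMX.
  - move=> x /sp[x0]; rewrite pE rootM => /orP[//|].
    by rewrite rootX => /eqP xE; rewrite xE ltxx in x0.
have sz_e' : (size e' < size e)%N.
  rewrite size_map size_filter -(count_predC (fun i => i != 0%N) e).
  rewrite -[ltnLHS]addn0 ltn_add2l -has_count.
  by apply/hasP; exists 0%N => //; apply: pe.
have [p'0|p'0] := eqVneq p^`() 0.
  case: s us sp => [_ _|x s _ sp]; first by apply: leq_trans sz_e'.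
  have [_ /rootP px] := sp x (mem_head x s); case/eqP: p00; move: px.
  have : (size p <= 1)%N.
    apply/leq_sizeP => [[//|i] _]; have /esym/eqP := coef_deriv p i.
    by rewrite p'0 coef0 mulrn_eq0 => /eqP.
  by move=> /size1_polyC ->; rewrite hornerC coefC.
case: s us sp => [|x0 s0] us sp; first exact: leq_trans sz_e'.
set s1 := x0 :: s0 in us sp *.
have ss : sorted <%R (sort <=%R s1) by rewrite sort_lt_sorted.
have mem_ss x : x \in sort <=%R s1 -> 0 < x /\ root p x by rewrite mem_sort => /sp.
have sz_ss : size (sort <=%R s1) = size s1 by rewrite size_sort.
case: (sort <=%R s1) ss mem_ss sz_ss => [|x s] //= ss mem_ss [sz_s].
have [|s' [sz_s' xs' p's']] := @rolle_path p x s ss.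
  by apply/allP => y /mem_ss[].
rewrite /s1 /= -sz_s -sz_s' (leq_trans _ sz_e') // ltnS.
apply: (IHn p^`()) => //.
- by apply: leq_trans len; apply: lt_size_deriv.
- by move=> i; rewrite coef_deriv => pi; apply/mem_e'/pe; apply: contraNneq pi => ->; rewrite mul0rn.
- by apply: (sorted_uniq lt_trans ltxx); apply: path_sorted xs'.
move=> y ys'; split; last exact: (allP p's').
have [x0' _] := mem_ss x (mem_head _ _).
by apply: lt_trans x0' _; apply: (allP (order_path_min lt_trans xs')).
Qed.
End Descartes.

(** * Invariants of the anharmonic group *)

Section PolyNat.
Variable F : numFieldType.
Implicit Types p q : {poly F}.

Lemma eq_poly_horner_nat p q (N : nat) :
  (forall n : nat, (N < n)%N -> p.[n%:R] = q.[n%:R]) -> p = q.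
Proof.
move=> pq; apply/eqP; rewrite -subr_eq0; apply/negPn/negP => d0.
pose s := [seq n%:R : F | n <- iota N.+1 (size (p - q))].
have : (size s < size (p - q)%R)%N.
  apply: max_poly_roots => //.
    apply/allP => x /mapP[n]; rewrite mem_iota => /andP[Nn _] ->.
    by rewrite rootE !hornerE pq ?subrr.
  by rewrite map_inj_uniq ?iota_uniq //; apply: mulrIn; rewrite oner_eq0.
by rewrite size_map size_iota ltnn.
Qed.

(** The functional equation is the form in which the symmetry arises, its
    translation to coefficients the form in which it controls the degree. *)
Lemma palindromic_coef p n : (size p <= n.+1)%N ->
  (forall x, x != 0 -> x ^+ n * p.[x^-1] = p.[x]) ->
  forall j, (j <= n)%N -> p`_j = p`_(n - j).
Proof.
move=> szp pal j lejn; have pE : p = \poly_(i < n.+1) p`_(n - i).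
  apply: (@eq_poly_horner_nat _ _ 0) => k k0.
  have x0 : k%:R != 0 :> F by rewrite pnatr_eq0 -lt0n.
  rewrite -pal // horner_poly (horner_coef_wide _ szp) mulr_sumr.
  rewrite (reindex_inj rev_ord_inj) /=; apply: eq_bigr => i _.
  rewrite subSS mulrCA; congr (_ * _).
  by rewrite -{1}(subnKC (leq_ord i)) exprD exprVn mulfK ?expf_neq0.
by rewrite {1}pE coef_poly ltnS lejn.
Qed.

Lemma poly_comp_1subX p x : p \Po (1 - 'X) = p -> p.[1 - x] = p.[x].
Proof. by move=> {2}<-; rewrite horner_comp !hornerE. Qed.

(** The zeros of [anharmQ] are the two points fixed by the elements of order three
    of the anharmonic group, those of [anharmC], together with infinity, the
    orbit of 0. *)
Definition anharmQ : {poly F} := 1 - 'X + 'X^2.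
Definition anharmC : {poly F} := 'X * (1 - 'X).

(** Subtract p(0) Q^m, so that p vanishes at 0 and 1. The zero at 1 is double:
    differentiating x^(2m) p(1/x) = p(x) at 1 gives 2m p(1) = 2 p'(1). By the
    symmetry x -> 1 - x the zero at 0 is double too, and p / C^2 is an invariant
    for m - 3. *)
Lemma anharmonic_invariant m p : (size p <= (2 * m).+1)%N ->
  p \Po (1 - 'X) = p ->
  (forall x, x != 0 -> x ^+ (2 * m) * p.[x^-1] = p.[x]) ->
  exists c : nat -> F,
    p = \sum_(k < (m %/ 3).+1) c k *: (anharmQ ^+ (m - 3 * k) * anharmC ^+ (2 * k)).
Proof.
elim/ltn_ind: m p => m IHm p szp sym pal.
have hQ x : anharmQ.[x] = 1 - x + x ^+ 2 by rewrite !hornerE.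
pose hE := (hQ, horner_exp, hornerZ, hornerN, hornerD).
pose p1 := p - p`_0 *: anharmQ ^+ m.
have szQ : (size (anharmQ ^+ m) <= (2 * m).+1)%N.
  rewrite (leq_trans (size_exp_leq _ _)) // ltnS.
  rewrite leq_mul2r; apply/orP; right.
  have : (size anharmQ <= 3)%N; last by case: (size _).
  rewrite /anharmQ (leq_trans (size_polyD _ _)) // geq_max size_polyXn andbT.
  by rewrite (leq_trans (size_polyD _ _)) // size_polyN size_polyX size_poly1.
have szp1 : (size p1 <= (2 * m).+1)%N.
  rewrite (leq_trans (size_polyD _ _)) // geq_max szp size_polyN.
  by rewrite (leq_trans (size_scale_leq _ _)).
have sym1 x : p1.[1 - x] = p1.[x].
  rewrite /p1 !hE (poly_comp_1subX _ sym).
  by congr (_ - _ * _ ^+ _); ring.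
have pal1 x : x != 0 -> x ^+ (2 * m) * p1.[x^-1] = p1.[x].
  move=> x0; rewrite /p1 !hE mulrBr pal //; congr (_ - _).
  rewrite mulrCA; congr (_ * _); rewrite exprM -exprMn; congr (_ ^+ _).
  by field.
have p10 : p1.[0] = 0.
  by rewrite /p1 !hE horner_coef0 subr0 expr0n addr0 expr1n mulr1 subrr.
have p11 : p1.[1] = 0 by rewrite -p10 -(sym1 1) subrr.
have div2 (r : {poly F}) : r.[0] = 0 -> r.[1] = 0 -> exists q, r = q * anharmC.
  move=> /rootP/factor_theorem[r1 ->]; rewrite subr0 !hornerE.
  move=> /rootP/factor_theorem[r2 ->]; exists (- r2).
  by rewrite /anharmC polyC1; ring.
have hC x : anharmC.[x] = x * (1 - x) by rewrite !hornerE.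
pose hE' := (hC, horner_exp, hornerM).
have [r2 p1E] := div2 _ p10 p11.
have pcoef := palindromic_coef szp1 pal1.
have dp1 : p1^`().[1] = 0.
  have -> : p1 = \sum_(j < (2 * m).+1) p1`_j *: 'X^j.
    by rewrite -poly_def; apply/polyP => j; rewrite coef_poly;
       case: ltnP => // lej; rewrite nth_default // (leq_trans szp1).
  rewrite linear_sum /= horner_sum.
  under eq_bigr => j _ do rewrite linearZ /= derivXn !hornerE hornerMn hornerXn expr1n.
  set S := \sum_(_ < _) _.
  have : S + S = 0; last by move/eqP; rewrite -mulr2n mulrn_eq0 => /eqP.
  rewrite {2}/S (reindex_inj rev_ord_inj) /= -big_split /=.
  transitivity (p1.[1] *+ (2 * m)); last by rewrite p11 mul0rn.
  rewrite (horner_coef_wide _ szp1) -sumrMnl; apply: eq_bigr => j _.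
  rewrite subSS -pcoef ?leq_ord // expr1n -mulrDr -natrD subnKC ?leq_ord //.
  by rewrite mulr1 mulr_natr.
have r21 : r2.[1] = 0.
  move: dp1; rewrite p1E derivM !hornerE /anharmC derivM !derivE !hornerE /= => dp1.
  by apply: oppr_inj; rewrite oppr0 -dp1; ring.
have natx (n : nat) : (1 < n)%N -> n%:R != 0 :> F /\ 1 - n%:R != 0 :> F.
  move=> n1; split; first by rewrite pnatr_eq0; lia.
  by rewrite subr_eq0 eq_sym (eqr_nat _ n 1); lia.
have r20 : r2.[0] = 0.
  suff r2s : r2 \Po (1 - 'X) = r2 by rewrite -(poly_comp_1subX 0 r2s) subr0.
  apply: (@eq_poly_horner_nat _ _ 1) => n /natx[n0 n1].
  apply: (@mulIf _ (n%:R * (1 - n%:R))); first by rewrite mulf_neq0.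
  have := sym1 n%:R; rewrite p1E !hE' horner_comp !hornerE => <-.
  rewrite /=; ring.
have [q r2E] := div2 _ r20 r21.
have {r2E}p1E : p1 = q * anharmC ^+ 2 by rewrite p1E r2E; ring.
have szp1' : (size p1 <= (2 * m).-1)%N.
  apply/leq_sizeP => j lej; have [ltj|/pcoef->] := ltnP (2 * m) j.
    by apply: nth_default; apply: leq_trans szp1 _.
  have : (2 * m - j < 2)%N by lia.
  have -> : p1 = q * (1 - 'X) ^+ 2 * 'X^2 by rewrite p1E /anharmC; ring.
  by rewrite coefMXn => ->.
have szC : size (anharmC ^+ 2) = 5%N.
  have -> : anharmC ^+ 2 = ('X - 1%:P) ^+ 2 * 'X^2 by rewrite /anharmC polyC1; ring.
  by rewrite size_mulXn ?expf_neq0 ?polyXsubC_eq0 // size_exp_XsubC.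
have C0 : anharmC ^+ 2 != 0 by rewrite -size_poly_eq0 szC.
have pE : p = p`_0 *: anharmQ ^+ m + p1 by rewrite /p1 addrC subrK.
have [q0|q0] := eqVneq q 0.
  exists (fun k => if k == 0%N then p`_0 else 0).
  rewrite big_ord_recl /= big1; last by move=> k _; rewrite scale0r.
  by rewrite {1}pE p1E q0 mul0r muln0 subn0 mulr1.
have szq : (size q + 5 <= 2 * m)%N.
  move: szp1'; rewrite p1E size_mul // szC; have : (0 < size q)%N by rewrite lt0n size_poly_eq0.
  by move: (size _) => s; lia.
have sz0 : (0 < size q)%N by rewrite lt0n size_poly_eq0.
have m3 : (3 <= m)%N by lia.
have [||||c qE] := IHm (m - 3)%N _ q.
- by lia.
- by lia.
- apply: (@eq_poly_horner_nat _ _ 1) => n /natx[n0 n1].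
  apply: (@mulIf _ ((n%:R * (1 - n%:R)) ^+ 2)); first by rewrite expf_neq0 ?mulf_neq0.
  have := sym1 n%:R; rewrite p1E !hE' horner_comp !hornerE => <-.
  rewrite /=; ring.
- move=> x x0; have [->|x1] := eqVneq x 1; first by rewrite invr1 expr1n mul1r.
  have x1' : 1 - x != 0 by rewrite subr_eq0 eq_sym.
  apply: (@mulIf _ ((x * (1 - x)) ^+ 2)); first by rewrite expf_neq0 ?mulf_neq0.
  have := pal1 x x0; rewrite p1E !hE' => <-.
  have -> : (2 * m = 2 * (m - 3) + 6)%N by lia.
  rewrite exprD; move: (x ^+ (2 * (m - 3))) q.[x^-1] => u v.
  by field.
exists (fun k => if k is k'.+1 then c k' else p`_0).
have -> : (m %/ 3 = ((m - 3) %/ 3).+1)%N by lia.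
rewrite big_ord_recl muln0 subn0 mulr1 {1}pE; congr (_ + _).
rewrite p1E {1}qE mulr_suml; apply: eq_bigr => k _ /=.
rewrite /bump leq0n add1n -scalerAl -mulrA -exprD; congr (_ *: (_ ^+ _ * _ ^+ _)); lia.
Qed.
End PolyNat.

(** * Roots in the right half-plane *)

Section Factor.
Variable C : numClosedFieldType.
Implicit Types (P B : {poly C}) (s : seq C).

Lemma norm_ge_Re (z : C) : `|'Re z| <= `|z|.
Proof.
rewrite -(ler_pXn2r (n := 2)) ?nnegrE // real_normK ?Creal_Re // normC2_Re_Im.
by rewrite lerDl -realEsqr Creal_Im.
Qed.

(** The roots have sum 3, and the product of the distances of 2 to them is 1.
    Two roots with real part at most 0 would be at distance at least 2 from 2,
    and the third one, with real part at least 3, at distance at least 1. *)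
Lemma cubic_right_roots (l : C) : exists a b c : C,
  [/\ ('X - 1%:P) ^+ 3 - l *: ('X - 2%:P)
        = ('X - a%:P) * ('X - b%:P) * ('X - c%:P), 0 < 'Re a & 0 < 'Re b].
Proof.
set P := _ - _; have szP : size P = 4%N.
  rewrite size_polyDl size_exp_XsubC // size_polyN.
  by rewrite (leq_ltn_trans (size_scale_leq _ _)) ?size_XsubC.
have lP : lead_coef P = 1.
  rewrite lead_coefDl; last first.
    by rewrite size_exp_XsubC size_polyN (leq_ltn_trans (size_scale_leq _ _)) ?size_XsubC.
  by apply/monicP; rewrite monic_exp ?monicXsubC.
have [r] := closed_field_poly_normal P; rewrite lP scale1r => PE.
have : size r = 3%N by move: szP; rewrite PE size_prod_XsubC => -[].
case: r PE => [|a [|b [|c []]]] // PE _; rewrite !big_cons big_nil mulr1 mulrA in PE.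
have P2 : (2 - a) * (2 - b) * (2 - c) = 1.
  transitivity P.[2]; first by rewrite PE !hornerE.
  by rewrite /P !hornerE; ring.
have sum3 : a + b + c = 3.
  have hP x : P.[x] = (x - a) * (x - b) * (x - c) by rewrite PE !hornerE.
  (* The second difference isolates the coefficient of X^2. *)
  have h1 : P.[1] + P.[-1] - 2 * P.[0] = - 2 * 3 by rewrite /P !hornerE /=; ring.
  have /mulfI : - 2 != 0 :> C by rewrite oppr_eq0 pnatr_eq0.
  by apply; rewrite -h1 !hP; ring.
have bad (x y z : C) : (2 - x) * (2 - y) * (2 - z) = 1 -> x + y + z = 3 ->
    'Re x <= 0 -> 'Re y <= 0 -> False.
  move=> xyz2 xyz3 x0 y0.
  have R2 u : 'Re (2 - u) = 2 - 'Re u.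
    by rewrite raddfB /= (Creal_ReP 2 _) ?rpred_nat.
  have x2 : 2 <= `|2 - x|.
    apply: le_trans (norm_ge_Re _); rewrite R2 ger0_norm; first by rewrite lerDl oppr_ge0.
    by rewrite subr_ge0 (le_trans x0).
  have y2 : 2 <= `|2 - y|.
    apply: le_trans (norm_ge_Re _); rewrite R2 ger0_norm; first by rewrite lerDl oppr_ge0.
    by rewrite subr_ge0 (le_trans y0).
  have z1 : 1 <= `|2 - z|.
    apply: le_trans (norm_ge_Re _).
    have -> : 2 - z = x + y - 1 by rewrite -(addrK z (x + y)) xyz3; ring.
    have -> : 'Re (x + y - 1) = 'Re x + 'Re y - 1.
      by rewrite raddfB raddfD /= (Creal_ReP 1 _) ?rpred1.
    have xy0 : 'Re x + 'Re y <= 0 by rewrite -[leRHS]addr0 lerD.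
    rewrite ler0_norm; last by rewrite subr_le0 (le_trans _ ler01).
    by rewrite opprB lerDl oppr_ge0.
  have : 4 <= `|(2 - x) * (2 - y) * (2 - z)|.
    rewrite !normrM; have -> : 4 = 2 * 2 * 1 :> C by ring.
    by rewrite ler_pM ?mulr_ge0 // ler_pM.
  by rewrite xyz2 normr1 (ler_nat _ 4 1).
have [a0|a0] := real_ltP (real0 C) (Creal_Re a); last first.
  exists b, c, a; split; first by rewrite PE; ring.
    have [//|b0] := real_ltP (real0 C) (Creal_Re b).
    by case: (bad a b c).
  have [//|c0] := real_ltP (real0 C) (Creal_Re c).
  case: (bad a c b) => //; [rewrite -[RHS]P2|rewrite -[RHS]sum3]; ring.
have [b0|b0] := real_ltP (real0 C) (Creal_Re b); first by exists a, b, c.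
exists a, c, b; split=> //; first by rewrite PE; ring.
have [//|c0] := real_ltP (real0 C) (Creal_Re c).
case: (bad b c a) => //; [rewrite -[RHS]P2|rewrite -[RHS]sum3]; ring.
Qed.

(** The homogenisation of P in degree t, with A and B substituted for the two
    variables. *)
Definition homog2 t P (A B : {poly C}) :=
  \sum_(k < t.+1) P`_k *: (A ^+ (t - k) * B ^+ k).

Lemma homog2_lower t P A B : (size P <= t.+1)%N ->
  homog2 t.+1 P A B = A * homog2 t P A B.
Proof.
move=> szP; rewrite /homog2 big_ord_recr /= (nth_default _ szP) scale0r addr0.
rewrite mulr_sumr; apply: eq_bigr => k _.
by rewrite subSn ?leq_ord // exprS -mulrA scalerAr.
Qed.

Lemma homog2_root t P A B z : (size P <= t.+1)%N ->
  homog2 t.+1 (P * ('X - z%:P)) A B = (B - z *: A) * homog2 t P A B.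
Proof.
move=> szP; have -> : homog2 t.+1 (P * ('X - z%:P)) A B =
    homog2 t.+1 (P * 'X) A B - z *: homog2 t.+1 P A B.
  rewrite /homog2 scaler_sumr -sumrB; apply: eq_bigr => k _.
  by rewrite mulrBr coefB coefMC scalerBl scalerA [_ * z]mulrC.
rewrite (homog2_lower _ _ szP) mulrBl -scalerAl; congr (_ - _).
rewrite /homog2 big_ord_recl coefMX /= scale0r add0r mulr_sumr.
apply: eq_bigr => k _; rewrite /bump leq0n add1n coefMX /= subSS.
by rewrite exprS mulrCA scalerAr.
Qed.

(** Each root z of P contributes a factor B - z A, and each unit by which the
    degree of P falls short of t a factor A. With A = (X-1)^3 and B = X - 2 every
    such factor has at least one more root in the right half-plane than outside:
    three to none for A, one to none for z = 0, and two to one or better for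
    other z by [cubic_right_roots]. The factor called B in the conclusion
    collects the other roots. *)
Lemma homog2_right_roots t P : (size P <= t.+1)%N -> exists s B,
  [/\ homog2 t P (('X - 1%:P) ^+ 3) ('X - 2%:P) = \prod_(z <- s) ('X - z%:P) * B,
    forall z, z \in s -> 0 < 'Re z & (size B + t <= (size s).+1)%N].
Proof.
have re1 : 0 < 'Re 1 :> C by rewrite (Creal_ReP 1 _) ?rpred1.
have re2 : 0 < 'Re 2 :> C by rewrite (Creal_ReP 2 _) ?rpred_nat.
elim: t P => [|t IHt] P szP.
  exists [::], (P`_0)%:P; rewrite /homog2 big_ord1 mulr1 big_nil mul1r alg_polyC.
  by split=> //; rewrite addn0 size_polyC leq_b1.
have [szP'|] := leqP (size P) t.+1.
  have [s [B [PE s0 szB]]] := IHt P szP'.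
  exists (1 :: 1 :: s), (('X - 1%:P) * B); split.
  - by rewrite homog2_lower // PE !big_cons; ring.
  - by move=> z; rewrite !inE => /or3P[/eqP->|/eqP->|/s0].
  have := size_polyMleq ('X - 1%:P) B; rewrite size_XsubC /= => szB'.
  by rewrite (leq_trans (leq_add szB' (leqnn _))) // addSn addnS !ltnS.
move=> szP'; have : size P != 1%N by lia.
move=> /closed_rootP[z /factor_theorem[P' PE]].
have szP1 : (size P' <= t.+1)%N.
  have [->|P'0] := eqVneq P' 0; first by rewrite size_poly0.
  by move: szP; rewrite PE size_Mmonic ?monicXsubC // size_XsubC addn2.
have [s [B [P'E s0 szB]]] := IHt P' szP1.
have [z0|z0] := eqVneq z 0.
  exists (2 :: s), B; split.
  - by rewrite PE homog2_root // z0 scale0r subr0 P'E big_cons mulrA.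
  - by move=> x; rewrite !inE => /orP[/eqP->|/s0].
  by rewrite addnS.
have [a [b [c [abc a0 b0]]]] := cubic_right_roots z^-1.
exists (a :: b :: s), ((- z) *: (('X - c%:P) * B)); split.
- have cE : ('X - 2%:P) - z *: ('X - 1%:P) ^+ 3 =
      (- z) *: (('X - a%:P) * ('X - b%:P) * ('X - c%:P)).
    by rewrite -abc scalerBr scalerA mulNr mulfV // scaleN1r opprK scaleNr addrC.
  by rewrite PE homog2_root // cE P'E !big_cons -!mul_polyC; ring.
- by move=> x; rewrite !inE => /or3P[/eqP->|/eqP->|/s0].
have := size_polyMleq ('X - c%:P) B; rewrite size_XsubC /= => szB'.
rewrite (leq_trans (leq_add (size_scale_leq _ _) (leqnn _))) //.
by rewrite (leq_trans (leq_add szB' (leqnn _))) // addSn addnS !ltnS.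
Qed.
End Factor.

(** * Real roots of a real part *)

Section RealRoots.
Variable C : numClosedFieldType.
Local Notation conjp := (map_poly (@Num.conj C)).

(** The argument of A turns by pi (size s) along the real line, and G can undo at
    most pi (size G - 1) of it. In algebraic terms: with S the product of the
    X - x over the real roots x of odd multiplicity, g S is a nonzero real
    multiple of some K conj(K) and equals (S G) A plus its conjugate; if S had
    too small a degree, [norm_sqr_upper_half_plane] would give K = 0. *)
Lemma many_real_roots (s : seq C) (G : {poly C}) : (forall z, z \in s -> 0 < 'Im z) ->
  let A := \prod_(z <- s) ('X - z%:P) in
  let g := G * A + conjp (G * A) in g != 0 ->
  exists T : seq C, [/\ uniq T, forall x, x \in T -> x \is Num.real /\ root g x
    & (size s <= size T + size G)%N].
Proof.
move=> s_up A g g0.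
have gR : conjp g = g by rewrite /g rmorphD /= conjpK addrC.
have [T [K [e [uT Troot [e0 eR] gT]]]] := real_poly_norm_sqr g0 gR.
exists T; split=> //; rewrite leqNgt; apply/negP => small.
pose S : {poly C} := \prod_(x <- T) ('X - x%:P).
have S0 : S != 0 by rewrite monic_neq0 // monic_prod_XsubC.
have SR : conjp S = S.
  rewrite /S rmorph_prod big_seq [RHS]big_seq; apply: eq_bigr => x /Troot[xR _].
  by rewrite rmorphB /= map_polyX map_polyC /= (CrealP xR).
pose G1 := e^-1 *: (S * G).
have szG1 : (size G1 <= (size s).-1)%N.
  rewrite (leq_trans (size_scale_leq _ _)) // (leq_trans (size_polyMleq _ _)) //.
  by rewrite /S size_prod_XsubC addSn /=; case: (size s) small.
have szA : size A = (size s).+1 by rewrite size_prod_XsubC.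
have KK : K * conjp K = G1 * A + conjp (G1 * A).
  have -> : K * conjp K = e^-1 *: (g * S) by rewrite gT scalerA mulVf // scale1r.
  rewrite /G1 /g -!scalerAl map_polyZ /= fmorphV /= (CrealP eR) -scalerDr.
  by congr (_ *: _); rewrite !rmorphM /= SR; ring.
have K0 : K != 0.
  apply: contraNneq (mulf_neq0 g0 S0) => K0.
  by rewrite gT K0 mul0r scaler0.
have szK : (size K <= size s)%N.
  have : (size (K * conjp K)%R <= (size s).-1 + size s)%N.
    rewrite KK (leq_trans (size_polyD _ _)) // geq_max size_conjp andbb.
    by rewrite (leq_trans (size_polyMleq _ _)) // szA addnS /= leq_add2r.
  rewrite size_mul ?size_conjp //; last by rewrite -size_poly_eq0 size_conjp size_poly_eq0.
  by move: (size K) (size s) => k n; lia.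
by case/eqP: K0; apply: (norm_sqr_upper_half_plane s_up szK szG1 KK).
Qed.
End RealRoots.

(** * Odd parts of anharmonic invariants *)

Section Core.
Variable R : rcfType.
Local Notation C := R[i].
Local Notation rc := (real_complex R).

(** The counting argument that gives independence. On the imaginary axis x = i y
    the number x + 1/x equals - i (1/y - y), and i (p(x) - p(-x)) becomes
    y^m g(1/y - y), where g is twice the real part of a polynomial most of whose
    roots lie in the upper half-plane. Every real root of g comes from exactly
    one y > 0, which is a root of the polynomial H with at most 2 (size ns)
    monomials. *)
Lemma anharmonic_odd_part_free m (p : {poly R}) (ns : seq nat) (c : nat -> R) :
  uniq ns -> (forall n, n \in ns -> odd n /\ (n < m)%N) ->
  (2 * size ns < m %/ 3 + m %% 3)%N ->
  (size p <= (2 * m).+1)%N -> p \Po (1 - 'X) = p ->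
  (forall x, x != 0 -> x ^+ (2 * m) * p.[x^-1] = p.[x]) ->
  p - (p \Po (- 'X)) = \sum_(n <- ns) c n *: ('X^n + 'X^(2 * m - n)) ->
  forall n, n \in ns -> c n = 0.
Proof.
move=> uns nsP szns szp sym pal podd n0 n0s; apply/eqP/negPn/negP => cn0.
have [cc pE] := anharmonic_invariant szp sym pal.
set t := (m %/ 3)%N in pE szns; set al := (m %% 3)%N in szns.
have mE : m = (al + 3 * t)%N by rewrite /al /t; lia.
(* In terms of u = x + 1/x one has Q = x (u - 1) and C^2 = x^3 (u - 2), hence
   p = x^m qh(u) with qh = (u - 1)^al times the homogenisation of P at
   (u - 1)^3 and u - 2. *)
pose P : {poly C} := \poly_(k < t.+1) rc (cc k).
have [s0 [B [PE s0_right szB]]] := homog2_right_roots (size_poly _ _ : (size P <= t.+1)%N).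
pose s1 := nseq al 1 ++ s0.
pose qh : {poly C} := \prod_(z <- s1) ('X - z%:P) * B.
have s1_right z : z \in s1 -> 0 < 'Re z.
  rewrite mem_cat => /orP[|/s0_right//]; rewrite mem_nseq => /andP[_ /eqP->].
  by rewrite (Creal_ReP 1 _) ?rpred1.
have qhE : qh = \sum_(k < t.+1) rc (cc k) *: (('X - 1%:P) ^+ (m - 3 * k) * ('X - 2%:P) ^+ k).
  rewrite /qh /s1 big_cat /= -mulrA -PE big_nseq iter_mulr_1 /homog2 mulr_sumr.
  apply: eq_bigr => k _; rewrite coef_poly ltn_ord -scalerAr mulrA -exprM -exprD.
  by congr (_ *: (_ ^+ _ * _)); have := ltn_ord k; lia.
have pqh u : u != 0 -> (map_poly rc p).[u] = u ^+ m * qh.[u + u^-1].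
  move=> u0; rewrite pE qhE linear_sum !horner_sum mulr_sumr; apply: eq_bigr => k _.
  have lek : (3 * k <= m)%N by have := ltn_ord k; rewrite /t; lia.
  have QE : (map_poly rc (anharmQ R)).[u] = u * (u + u^-1 - 1).
    rewrite /anharmQ rmorphD rmorphB /= rmorph1 map_polyX map_polyXn !hornerE.
    by field.
  have CE : (map_poly rc (anharmC R)).[u] ^+ 2 = u ^+ 3 * (u + u^-1 - 2).
    rewrite /anharmC rmorphM rmorphB /= rmorph1 map_polyX !hornerE /=.
    by field.
  rewrite /= map_polyZ rmorphM !rmorphXn /= hornerZ hornerM !horner_exp QE.
  rewrite exprM CE hornerZ hornerM !horner_exp !hornerXsubC.
  rewrite [RHS]mulrCA; congr (_ * _); rewrite (exprMn (m - 3 * k)) (exprMn k) -exprM.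
  by rewrite mulrACA -exprD subnK.
(* The rotation u = - i eta carries the right half-plane to the upper one. *)
pose A : {poly C} := \prod_(z <- [seq 'i * z | z <- s1]) ('X - z%:P).
pose G : {poly C} := ('i * 'i ^+ m * (- 'i) ^+ size s1) *: (B \Po (- 'i *: 'X)).
pose g := G * A + map_poly (@Num.conj C) (G * A).
have iN0 : - 'i != 0 :> C by rewrite oppr_eq0 neq0Ci.
have szG : size G = size B.
  rewrite /G size_scale ?mulf_neq0 ?expf_neq0 ?neq0Ci //.
  by rewrite size_comp_poly2 // size_scale // size_polyX.
have GAE eta : (G * A).[eta] = 'i * 'i ^+ m * qh.[- 'i * eta].
  have rot (s : seq C) : (- 'i) ^+ size s * \prod_(z <- s) (eta - 'i * z) =
      \prod_(z <- s) (- 'i * eta - z).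
    elim: s => [|z s IHs]; first by rewrite !big_nil mulr1.
    rewrite !big_cons -IHs /= exprS mulrACA; congr (_ * _).
    transitivity (- 'i * eta + 'i ^+ 2 * z); first by ring.
    by rewrite sqrCi mulN1r.
  rewrite /G /A /qh !hornerM hornerZ horner_comp !horner_prod big_map.
  under eq_bigr do rewrite hornerXsubC.
  under [X in _ = _ * (X * _)]eq_bigr do rewrite hornerXsubC.
  by rewrite -rot hornerZ hornerX; ring.
(* H(y) is i times the given odd part at i y; the signs come from
   i i^n = (-1)^((n+1)/2) for odd n. *)
pose H : {poly R} := \sum_(n <- ns) c n *:
  ((-1) ^+ uphalf n *: 'X^n + (-1) ^+ uphalf (2 * m - n) *: 'X^(2 * m - n)).
have gH (y : R) : y != 0 -> g.[rc (y^-1 - y)] * rc y ^+ m = rc H.[y].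
  move=> y0; have rcy0 : rc y != 0 by rewrite fmorph_eq0.
  have conj_rc (x : R) : (rc x)^* = rc x by apply/CrealP/complex_realP; exists x.
  pose X := (G * A).[rc (y^-1 - y)].
  have XE : X * rc y ^+ m = 'i * (map_poly rc p).['i * rc y].
    rewrite /X GAE pqh ?mulf_neq0 ?neq0Ci // exprMn invfM invCi.
    rewrite rmorphB /= fmorphV.
    have -> : 'i * rc y + - 'i / rc y = - 'i * ((rc y)^-1 - rc y) by ring.
    by ring.
  have conjpC : map_poly (@Num.conj C) (map_poly rc p) = map_poly rc p.
    by apply/polyP => j; rewrite !coef_map /= conj_rc.
  have -> : g.[rc (y^-1 - y)] = X + X^*.
    by rewrite /g hornerD -{2}conj_rc horner_map.
  have -> : (X + X^*) * rc y ^+ m =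
      'i * ((map_poly rc p).['i * rc y] - (map_poly rc p).[- ('i * rc y)]).
    rewrite mulrDl XE mulrBr; congr (_ + _).
    have -> : X^* * rc y ^+ m = (X * rc y ^+ m)^* by rewrite rmorphM rmorphXn /= conj_rc.
    rewrite XE rmorphM /= -horner_map /= conjpC rmorphM /= conjCi conj_rc.
    by rewrite !mulNr.
  have -> : (map_poly rc p).['i * rc y] - (map_poly rc p).[- ('i * rc y)] =
      (map_poly rc (p - (p \Po (- 'X)))).['i * rc y].
    by rewrite rmorphB /= map_comp_poly rmorphN /= map_polyX !hornerE horner_comp !hornerE.
  have iodd n : odd n -> 'i * ('i * rc y) ^+ n = rc ((-1) ^+ uphalf n * y ^+ n).
    move=> n_odd; rewrite exprMn mulrA -exprS rmorphM !rmorphXn /= rmorphN1.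
    congr (_ * _); rewrite -sqrCi -exprM; congr (_ ^+ _).
    by rewrite mul2n uphalfE; have := odd_double_half n.+1; rewrite /= n_odd.
  rewrite podd /H linear_sum !horner_sum rmorph_sum mulr_sumr big_seq [RHS]big_seq.
  apply: eq_bigr => n /nsP[n_odd nm]; rewrite /= map_polyZ rmorphD /= !map_polyXn.
  rewrite !hornerE /= [_ * rc _]mulrC -mulrA mulrDr iodd // iodd; last by rewrite oddB; lia.
  by rewrite -rmorphD -rmorphM.
have coefH j : H`_j = \sum_(n <- ns) c n * ((-1) ^+ uphalf n * (j == n)%:R
    + (-1) ^+ uphalf (2 * m - n) * (j == 2 * m - n)%N%:R).
  by rewrite /H coef_sum; apply: eq_bigr => n _; rewrite !coefE.
have Hn0 : H`_n0 != 0.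
  have [_ n0m] := nsP _ n0s.
  rewrite coefH (bigD1_seq n0) //= eqxx big1_seq ?addr0.
    have -> : (n0 == 2 * m - n0)%N = false by lia.
    by rewrite mulr1 mulr0 addr0 mulf_neq0 // signr_eq0.
  move=> n /andP[nn0 /nsP[_ nm]].
  have -> : (n0 == 2 * m - n)%N = false by lia.
  by rewrite eq_sym (negPf nn0) !mulr0 addr0 mulr0.
have H0 : H != 0 by apply: contraNneq Hn0 => ->; rewrite coef0.
have g0 : g != 0.
  apply: contraNneq H0 => g0; apply/eqP; apply: (@eq_poly_horner_nat _ _ _ 0) => n n_gt0.
  apply: (@complexI R); rewrite -gH ?pnatr_eq0 -?lt0n // g0 !horner0 mul0r.
  by rewrite rmorph0.
have Im_s1 z : z \in [seq 'i * z | z <- s1] -> 0 < 'Im z.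
  by move=> /mapP[x /s1_right x0 ->]; rewrite ImMil.
have [T [uT Troot szT]] := many_real_roots Im_s1 g0.
(* The positive solution y of 1/y - y = x. *)
pose yy (x : C) : R := (Num.sqrt (complex.Re x ^+ 2 + 4) - complex.Re x) / 2.
have yyP x : x \in T -> 0 < yy x /\ rc ((yy x)^-1 - yy x) = x.
  move=> /Troot[xR _]; set e := complex.Re x.
  have e4 : 0 <= e ^+ 2 + 4 by rewrite addr_ge0 ?sqr_ge0.
  have sq := sqr_sqrtr e4; have sq0 := sqrtr_ge0 (e ^+ 2 + 4).
  have y0 : 0 < yy x.
    rewrite /yy -/e divr_gt0 // subr_gt0 ltNge; apply/negP => le_e.
    move: sq; move: (Num.sqrt _) sq0 le_e => s sq0 le_e sq.
    have : s ^+ 2 <= e ^+ 2 by rewrite ler_sqr ?nnegrE // (le_trans sq0).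
    by rewrite sq; lra.
  split=> //; rewrite -[RHS](RRe_real xR); congr (rc _).
  have yn0 : yy x != 0 by rewrite gt_eqF.
  apply: (mulfI yn0); rewrite mulrBr mulfV // /yy -/e.
  move: (Num.sqrt _) sq => s sq; transitivity (1 - (s ^+ 2 - e * s *+ 2 + e ^+ 2) / 4).
    by field.
  by rewrite sq; field.
have : (size (map yy T) < size (ns ++ [seq 2 * m - n | n <- ns]))%N.
  apply: (size_positive_roots H0).
  - move=> j; apply: contraR; rewrite mem_cat negb_or => /andP[jns jns'].
    rewrite coefH big1_seq // => n /= nns.
    have -> : (j == n) = false by apply: contraNF jns => /eqP->.
    have -> : (j == 2 * m - n)%N = false.
      by apply: contraNF jns' => /eqP->; apply: map_f.
    by rewrite !mulr0 addr0 mulr0.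
  - rewrite map_inj_in_uniq // => x y /yyP[_ xE] /yyP[_ yE] xy.
    by rewrite -xE -yE xy.
  move=> _ /mapP[x xT ->]; have [y0 xE] := yyP x xT; split=> //.
  have [_ /rootP gx] := Troot x xT.
  apply/rootP/(@complexI R); rewrite -gH ?gt_eqF // xE gx mul0r.
  by rewrite rmorph0.
rewrite size_cat !size_map addnn -mul2n => szT2.
move: szT; rewrite size_map szG /s1 size_cat size_nseq => szT.
move: szns szB szT szT2; clear.
by move: (size ns) (size B) (size s0) (size T) t al => ? ? ? ? ? ?; lia.
Qed.
End Core.

(** * Bernoulli polynomials *)

Section BernoulliFacts.
Variable F : numFieldType.
Local Notation B := (bernpoly F).

Lemma bernpoly_sum n : \sum_(j < n.+1) B j *+ 'C(n.+1, j) = n.+1%:R *: 'X^n.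
Proof.
have n1 : n.+1%:R != 0 :> F by rewrite pnatr_eq0.
rewrite big_ord_recr /= bernpolyE binSn -scaler_nat scalerBr scalerA mulfV //.
by rewrite scale1r addrC subrK.
Qed.

Lemma bernpoly_shift n : B n \Po ('X + 1) - B n = n%:R *: 'X^(n.-1).
Proof.
elim/ltn_ind: n => n IHn.
have n1 : n.+1%:R != 0 :> F by rewrite pnatr_eq0.
apply: (scalerI n1).
have := bernpoly_sum n => /(congr1 (fun p => p \Po ('X + 1) - p)).
rewrite linear_sum /= -sumrB.
under eq_bigr => j _ do rewrite raddfMn /= -mulrnBl.
rewrite big_ord_recr /= binSn => H.
rewrite [LHS]scaler_nat; move/(canRL (addKr _)): H => ->.
under eq_bigr => j _ do rewrite (IHn j) //.
rewrite linearZ /= rmorphXn /= comp_polyX -scalerBr.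
have -> : ('X + 1) ^+ n - 'X^n = \sum_(i < n) 'X^i *+ 'C(n, i) :> {poly F}.
  rewrite ['X + 1]addrC exprDn big_ord_recr /= subnn expr0 mul1r binn mulr1n addrK.
  by apply: eq_bigr => i _; rewrite expr1n mul1r.
case: n {IHn n1} => [|n]; first by rewrite !big_ord0 scale0r !scaler0 oppr0 addr0.
rewrite [X in - X]big_ord_recl [X in _ + _ *: X]big_ord_recr /= scale0r mul0rn add0r binSn scalerDr addrA.
rewrite addrC [X in _ + X](_ : _ = 0) ?addr0; first by rewrite scaler_nat.
rewrite addrC; apply/eqP; rewrite subr_eq0; apply/eqP.
rewrite scaler_sumr; apply: eq_bigr => i _; rewrite /bump leq0n add1n /=.
rewrite -!scaler_nat !scalerA -!natrM; congr (_%:R *: _).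
by rewrite mul_bin_diag mulnC.
Qed.

Lemma horner_bernpoly_shift l x : (B l).[x + 1] = (B l).[x] + l%:R * x ^+ l.-1.
Proof.
have /(congr1 (fun p => p.[x])) := bernpoly_shift l.
by rewrite !hornerE horner_comp !hornerE => <-; rewrite [RHS]addrC subrK.
Qed.

(** For even n the difference B_n(1-x) - B_n(x) has period 1, hence is constant,
    and it vanishes at x = 1/2. *)
Lemma bernpoly_refl n : ~~ odd n -> B n \Po (1 - 'X) = B n.
Proof.
move=> n_even; pose D := B n \Po (1 - 'X) - B n.
have Dx x : D.[x] = (B n).[1 - x] - (B n).[x] by rewrite !hornerE horner_comp !hornerE.
have Dshift x : D.[x + 1] = D.[x].
  rewrite !Dx horner_bernpoly_shift; have -> : 1 - (x + 1) = - x by ring.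
  have -> : 1 - x = - x + 1 by ring.
  rewrite horner_bernpoly_shift; case: n n_even {D Dx} => [|n] /= /negPn n_odd.
    by rewrite !mul0r !addr0.
  by rewrite exprNn -signr_odd n_odd expr1; ring.
have D0 : D = (D.[0])%:P.
  apply: (@eq_poly_horner_nat _ _ _ 0) => k _; rewrite hornerC.
  by elim: k => // k IHk; rewrite -natr1 Dshift.
have : D.[2^-1] = 0.
  have h : 1 - 2^-1 = 2^-1 :> F by field.
  by rewrite Dx h subrr.
by rewrite D0 hornerC => D00; apply/eqP; rewrite -subr_eq0 -/D D0 D00.
Qed.
End BernoulliFacts.

(** * Even period polynomials *)

Section PeriodPolynomials.
Variable F : numFieldType.
Variable m : nat.
Local Notation w := (2 * m)%N.
Implicit Types (P : nat -> F) (f : F -> F -> F).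

Definition monom2 (j : nat) (a b : F) : F := a ^+ j * b ^+ (w - j).

Definition form P (a b : F) : F := \sum_(j < w.+1) P j * monom2 j a b.

(** The second condition is the Lewis form of the period relations. Evenness in
    each variable is a consequence, see [even_period_even]. *)
Definition even_period P :=
  (forall a b, form P a b = - form P b a) /\
  (forall a b, form P (a + b) b + form P a (a + b) = form P a b).

Lemma monom2C j a b : (j <= w)%N -> monom2 j a b = monom2 (w - j) b a.
Proof. by move=> lejw; rewrite /monom2 subKn // mulrC. Qed.

Lemma form_nat_inj P P' :
  (forall a : nat, (0 < a)%N -> form P a%:R 1 = form P' a%:R 1) ->
  forall j, (j <= w)%N -> P j = P' j.
Proof.
move=> PP' j lejw.
have h (Q : nat -> F) a : form Q a 1 = (\poly_(i < w.+1) Q i).[a].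
  by rewrite horner_poly; apply: eq_bigr => i _; rewrite /monom2 expr1n mulr1.
have : \poly_(i < w.+1) P i = \poly_(i < w.+1) P' i.
  by apply: (@eq_poly_horner_nat _ _ _ 0) => n n0; rewrite -!h PP'.
by move/(congr1 (fun p : {poly F} => p`_j)); rewrite !coef_poly ltnS lejw.
Qed.

Lemma even_period_anti P j : even_period P -> (j <= w)%N -> P j = - P (w - j)%N.
Proof.
move=> [anti _] lejw; apply: (form_nat_inj (P' := fun j => - P (w - j)%N)) => // a _.
rewrite anti /form (reindex_inj rev_ord_inj) /= -sumrN; apply: eq_bigr => i _.
by rewrite subSS mulNr [in RHS]monom2C ?leq_ord.
Qed.

Lemma formN P a b : form P (- a) (- b) = form P a b.
Proof.
apply: eq_bigr => j _; rewrite /monom2 (exprNn a) (exprNn b) mulrACA -exprD subnKC ?leq_ord //.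
by rewrite exprM sqrrN !expr1n mul1r.
Qed.

(** f(1,y) - f(1,-y) has period 1 in y by the three-term relation applied to
    (1,y) and (-1,1+y), hence is constant; being odd, it is zero. *)
Lemma even_period_even P j : even_period P -> odd j -> (j <= w)%N -> P j = 0.
Proof.
move=> PW j_odd lejw; have [anti lewis] := PW.
pose D : {poly F} := \poly_(i < w.+1) (P (w - i)%N) - (\poly_(i < w.+1) (P (w - i)%N) \Po (- 'X)).
have fE y : form P 1 y = (\poly_(i < w.+1) (P (w - i)%N)).[y].
  rewrite horner_poly /form (reindex_inj rev_ord_inj) /=; apply: eq_bigr => i _.
  by rewrite subSS /monom2 expr1n mul1r subKn ?leq_ord.
have DE y : D.[y] = form P 1 y - form P 1 (- y).
  by rewrite hornerD hornerN horner_comp !hornerE !fE.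
have Dshift y : D.[y + 1] = D.[y].
  have h1 := lewis 1 y; have h2 := lewis (- 1) (1 + y).
  rewrite addrA addNr add0r in h2.
  rewrite !DE [y + 1]addrC -h1 -[form P 1 (- y)]formN opprK -[form P 1 (- (1 + y))]formN opprK.
  by rewrite -h2 [form P y _]anti; ring.
have D0 : D = 0.
  apply: (@eq_poly_horner_nat _ _ _ 0) => n _; rewrite horner0.
  elim: n => [|n IHn]; last by rewrite -natr1 Dshift.
  by rewrite DE oppr0 subrr.
have PE : P j = (-1) ^+ j * P j.
  apply: (form_nat_inj (P' := fun j => (-1) ^+ j * P j)) => // a _.
  have -> : form (fun j => (-1) ^+ j * P j) a%:R 1 = form P (- a%:R) 1.
    by apply: eq_bigr => i _; rewrite /monom2 (exprNn a%:R) !mulrA [P i * _]mulrC.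
  rewrite anti [RHS]anti; congr (- _); apply/eqP; rewrite -subr_eq0 -DE D0.
  by rewrite horner0.
have : P j + P j = 0 by rewrite {1}PE -signr_odd j_odd expr1 mulN1r addNr.
by move/eqP; rewrite -mulr2n mulrn_eq0 => /eqP.
Qed.

(** The alternating sum of f over the six ordered pairs taken from the three
    numbers x, -y, y - x, whose sum is 0. *)
Definition alternate f (x y : F) : F :=
  f x (- y) - f (- y) x + f (- y) (y - x) - f (y - x) (- y)
  + f (y - x) x - f x (y - x).

(** With y = 1 these points keep x, -y and y - x away from 0, so that forms may be
    compared on pairs with nonzero second coordinate only. *)
Definition altpoint (l : nat) : F := l.+2%:R.

Lemma altpoint_neq0 l : altpoint l != 0 /\ 1 - altpoint l != 0.
Proof.
split; first by rewrite /altpoint pnatr_eq0.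
by rewrite subr_eq0 eq_sym (eqr_nat _ l.+2 1).
Qed.

Definition alt_mx : 'M[F]_(uphalf m, w.+1) :=
  \matrix_(i, l) alternate (monom2 i.*2) (altpoint l) 1.

Definition half_coef P : 'rV[F]_(uphalf m) := \row_i P i.*2.

Lemma sum_even_ord (n : nat) (h : nat -> F) : (forall j, odd j -> h j = 0) ->
  \sum_(j < n) h j = \sum_(i < uphalf n) h i.*2.
Proof.
move=> h0; elim: n => [|n IHn]; first by rewrite !big_ord0.
rewrite big_ord_recr /= IHn; have [n_odd|n_even] := boolP (odd n).
  by rewrite h0 // addr0 uphalf_half n_odd.
by rewrite uphalf_half (negPf n_even) add0n big_ord_recr /= even_halfK.
Qed.

Lemma form_even_period P a b : even_period P ->
  form P a b = \sum_(i < uphalf m) P i.*2 * (monom2 i.*2 a b - monom2 i.*2 b a).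
Proof.
move=> PW; pose h j := if odd j then 0 else P j * (monom2 j a b - monom2 j b a).
transitivity (\sum_(j < m) h j); last first.
  by rewrite sum_even_ord => [|j]; rewrite /h; [apply: eq_bigr => i _; rewrite odd_double|move=> ->].
have -> : form P a b = \sum_(j < m + m.+1) P j * monom2 j a b.
  by rewrite /form; have -> : w.+1 = (m + m.+1)%N by lia.
rewrite big_split_ord big_ord_recl /= addn0.
have -> : P m = 0.
  have Pm : P m = - P m by rewrite {1}(even_period_anti PW (leq_pmull m _)) //; congr (- P _); lia.
  have /eqP : P m *+ 2 = 0 by rewrite mulr2n {1}Pm addNr.
  by rewrite mulrn_eq0 => /eqP.
rewrite mul0r add0r [X in _ + X](reindex_inj rev_ord_inj) /= -big_split /=.
apply: eq_bigr => i _; have lti := ltn_ord i.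
have -> : (m + bump 0 (m - i.+1) = w - i)%N by rewrite /bump; lia.
have lei : (i <= w)%N by lia.
rewrite -monom2C // -[P (w - i)%N]opprK -even_period_anti // /h.
case: ifP => [i_odd|_]; last by ring.
by rewrite even_period_even // oppr0 !mul0r addr0.
Qed.

(** For an even antisymmetric form f the three-term relation says that the cyclic
    sum f(x,-y) + f(-y,y-x) + f(y-x,x) vanishes, and antisymmetrising the monomials
    of f turns this cyclic sum into the alternating one. *)
Lemma half_coef_ker P : even_period P -> half_coef P *m alt_mx = 0.
Proof.
move=> PW; apply/rowP => l; rewrite !mxE.
have [anti lewis] := PW.
have formN1 a b : form P (- a) b = form P a b.
  rewrite !form_even_period //; apply: eq_bigr => i _.
  have -> : i.*2 = (2 * i)%N by rewrite mul2n.
  by rewrite /monom2 -mulnBr !exprM sqrrN.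
have N0 x y : form P x (- y) + form P (- y) (y - x) + form P (y - x) x = 0.
  have := lewis (y - x) x; rewrite subrK => <-.
  rewrite -[form P (y - x) y]opprK -[- form P (y - x) y]anti.
  rewrite [form P x (- y)]anti !formN1; ring.
transitivity (form P (altpoint l) (- 1) + form P (- 1) (1 - altpoint l)
    + form P (1 - altpoint l) (altpoint l)); last exact: N0.
rewrite !form_even_period // -!big_split /=; apply: eq_bigr => i _.
by rewrite !mxE /alternate; ring.
Qed.

(** An alternating form in x, y, z with x + y + z = 0 is the product of the
    differences times a symmetric form, so a polynomial in e_2 and e_3; as the
    total degree 2m is even, the power of e_3 = xyz is odd. *)
Definition alt_form (b : nat) (x y : F) : F :=
  let z := - x - y in
  (x * y * z) ^+ (2 * b).+1 * ((x - y) * (y - z) * (z - x))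
  * (x * y + y * z + z * x) ^+ (m - 3 - 3 * b).

Definition alt_form_mx : 'M[F]_(m %/ 3, w.+1) :=
  \matrix_(b, l) alt_form b (altpoint l) (- 1).

(** [alt_form] on the line y = -1. *)
Definition alt_poly (b : nat) : {poly F} :=
  (- anharmC F) ^+ (2 * b).+1 * (('X + 1) * ('X - 2%:P) * (1 - 2 *: 'X))
  * (- anharmQ F) ^+ (m - 3 - 3 * b).

Lemma horner_alt_poly b x : (alt_poly b).[x] = alt_form b x (- 1).
Proof.
have hC : (anharmC F).[x] = x * (1 - x) by rewrite !hornerE.
have hQ : (anharmQ F).[x] = 1 - x + x ^+ 2 by rewrite !hornerE.
have hD : (('X + 1) * ('X - 2%:P) * (1 - 2 *: 'X)).[x] = (x + 1) * (x - 2) * (1 - 2 * x) :> F.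
  by rewrite !hornerE.
rewrite /alt_poly [in LHS]hornerM [in LHS]hornerM hD !horner_exp !hornerN hC hQ /alt_form.
by congr (_ ^+ _ * _ * _ ^+ _); ring.
Qed.

Lemma size_polyM_leq (p q : {poly F}) i j :
  (size p <= i.+1)%N -> (size q <= j.+1)%N -> (size (p * q)%R <= (i + j).+1)%N.
Proof.
move=> szp szq; rewrite (leq_trans (size_polyMleq _ _)) //.
by move: szp szq; move: (size p) (size q) => ? ?; lia.
Qed.

Lemma size_polyX_leq (p : {poly F}) i n :
  (size p <= i.+1)%N -> (size (p ^+ n)%R <= (i * n).+1)%N.
Proof.
move=> szp; rewrite (leq_trans (size_exp_leq _ _)) // ltnS leq_mul2r.
by apply/orP; right; case: (size p) szp.
Qed.

Lemma size_alt_poly b : (b < m %/ 3)%N -> (size (alt_poly b) <= w.+1)%N.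
Proof.
move=> ltb.
have s1 (c d : F) : (size (c%:P + d *: 'X)%R <= 2)%N.
  rewrite (leq_trans (size_polyD _ _)) // geq_max (leq_trans (size_polyC_leq1 _)) //.
  by rewrite (leq_trans (size_scale_leq _ _)) // size_polyX.
have szC : (size (- anharmC F) <= 3)%N.
  rewrite size_polyN; apply: (@size_polyM_leq _ _ 1 1); first by rewrite size_polyX.
  by have := s1 1 (-1); rewrite scaleN1r.
have szQ : (size (- anharmQ F) <= 3)%N.
  rewrite size_polyN (leq_trans (size_polyD _ _)) // geq_max size_polyXn andbT.
  by have := s1 1 (-1); rewrite scaleN1r => /leq_trans->.
have szD : (size (('X + 1) * ('X - 2%:P) * (1 - 2 *: 'X) : {poly F})%R <= 4)%N.
  apply: (@size_polyM_leq _ _ 2 1); first apply: (@size_polyM_leq _ _ 1 1) => //.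
  - by rewrite size_XaddC.
  - by rewrite size_XsubC.
  by have := s1 1 (-2); rewrite scaleNr.
have := size_polyM_leq (size_polyM_leq (size_polyX_leq (2 * b).+1 szC) szD)
  (size_polyX_leq (m - 3 - 3 * b) szQ).
by rewrite -/(alt_poly b) => /leq_trans; apply; lia.
Qed.

Lemma alt_form_scale b x y : (b < m %/ 3)%N -> y != 0 ->
  alt_form b x y = y ^+ w * alt_form b (- (x / y)) (- 1).
Proof.
move=> ltb y0; pose t := x / y; have -> : x = t * y by rewrite /t divfK.
rewrite mulfK // /alt_form.
have -> : y ^+ w = (- y) ^+ w by rewrite !exprM sqrrN.
have -> : t * y * y * (- (t * y) - y) = (- y) ^+ 3 * (- t * -1 * (- - t - -1)) by ring.
have -> : (t * y - y) * (y - (- (t * y) - y)) * (- (t * y) - y - t * y) =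
  (- y) ^+ 3 * ((- t - -1) * (-1 - (- - t - -1)) * (- - t - -1 - - t)) by ring.
have -> : t * y * y + y * (- (t * y) - y) + (- (t * y) - y) * (t * y) =
  (- y) ^+ 2 * (- t * -1 + -1 * (- - t - -1) + (- - t - -1) * - t) by ring.
rewrite (exprMn (2 * b).+1) (exprMn (m - 3 - 3 * b)) -!exprM.
rewrite [X in X * _ = _]mulrACA -exprD mulrACA -exprD; congr (_ ^+ _ * _); lia.
Qed.

Lemma alt_form_coef b : (b < m %/ 3)%N -> exists P, forall x y, y != 0 ->
  alt_form b x y = form P x y.
Proof.
move=> ltb; exists (fun j => (-1) ^+ j * (alt_poly b)`_j) => x y y0.
rewrite (alt_form_scale _ ltb y0) -horner_alt_poly (horner_coef_wide _ (size_alt_poly ltb)).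
rewrite /form mulr_sumr; apply: eq_bigr => j _; rewrite /monom2.
rewrite (exprNn (x / y)) expr_div_n -{1}(subnK (leq_ord j)) exprD.
by field; rewrite expf_neq0.
Qed.

Lemma alt_form_swap b x y : alt_form b y x = - alt_form b x y.
Proof.
rewrite /alt_form.
have -> : y * x * (- y - x) = x * y * (- x - y) by ring.
have -> : y * x + x * (- y - x) + (- y - x) * y = x * y + y * (- x - y) + (- x - y) * x by ring.
by rewrite -mulNr -mulrN; congr (_ * _ * _); ring.
Qed.

Lemma alt_form_rot b x y : alt_form b y (- x - y) = alt_form b x y.
Proof.
rewrite /alt_form.
have -> : - y - (- x - y) = x by ring.
by congr (_ ^+ _ * _ * _ ^+ _); ring.
Qed.

Lemma alternate_alt_form b x y :
  alternate (alt_form b) x y = 6 * alt_form b x (- y).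
Proof.
have r1 : alt_form b (- y) (y - x) = alt_form b x (- y).
  by rewrite -(alt_form_rot b x (- y)); congr alt_form; ring.
have r2 : alt_form b (y - x) x = alt_form b x (- y).
  by rewrite -r1 -(alt_form_rot b (- y) (y - x)); congr alt_form; ring.
rewrite /alternate [alt_form b (- y) x]alt_form_swap [alt_form b (y - x) (- y)]alt_form_swap.
by rewrite [alt_form b x (y - x)]alt_form_swap r1 r2; ring.
Qed.

(** The orders of vanishing at 0 are distinct. *)
Lemma triangular_poly_free k (u : nat -> {poly F}) (c : nat -> F) :
  (forall b, (u b)`_0 != 0) -> \sum_(b < k) c b *: (u b * 'X^(2 * b)) = 0 ->
  forall b, (b < k)%N -> c b = 0.
Proof.
move=> u0 sum0 b; elim/ltn_ind: b => b IHb ltb.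
have : (\sum_(b < k) c b *: (u b * 'X^(2 * b)))`_(2 * b) = 0 by rewrite sum0 coef0.
rewrite coef_sum (bigD1 (Ordinal ltb)) //= big1 ?addr0 => [|i ib].
  by rewrite coefZ coefMXn ltnn subnn => /eqP; rewrite mulf_eq0 (negPf (u0 b)) orbF => /eqP.
rewrite coefZ coefMXn; case: ltnP => [_|lei]; first by rewrite mulr0.
have ltib : (i < b)%N.
  by rewrite ltn_neqAle (_ : i <= b)%N ?andbT; [apply: contraNneq ib => ib; apply/eqP/val_inj|lia].
by rewrite IHb ?mul0r.
Qed.

Lemma alt_form_mx_free : row_free alt_form_mx.
Proof.
apply: inj_row_free => v vM.
pose c (b : nat) : F := if insub b is Some i then v 0 i else 0.
have cE (i : 'I_(m %/ 3)) : c i = v 0 i by rewrite /c valK.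
pose S := \sum_(b < m %/ 3) c b *: alt_poly b.
have S0 : S = 0.
  apply/eqP/negPn/negP => S_n0.
  have : (size [seq altpoint l | l <- iota 0 w.+1] < size S)%N.
    apply: max_poly_roots => //.
      apply/allP => x /mapP[l]; rewrite mem_iota add0n => /andP[_ ltl] ->.
      rewrite rootE /S horner_sum; have /rowP/(_ (Ordinal ltl)) := vM; rewrite !mxE => vM0.
      rewrite -[X in _ == X]vM0; apply/eqP/eq_bigr => i _.
      by rewrite hornerZ horner_alt_poly cE mxE.
    rewrite map_inj_uniq ?iota_uniq // => i j /eqP.
    by rewrite /altpoint eqr_nat => /eqP[].
  rewrite size_map size_iota ltnNge; apply/negP/negPn.
  rewrite (leq_trans (size_sum _ _ _)) //; apply/bigmax_leqP => b _.
  by rewrite (leq_trans (size_scale_leq _ _)) // size_alt_poly.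
pose u b : {poly F} := (1 - 'X) ^+ (2 * b) * (- anharmQ F) ^+ (m - 3 - 3 * b).
pose A : {poly F} := - anharmC F * (('X + 1) * ('X - 2%:P) * (1 - 2 *: 'X)).
have SE : S = A * \sum_(b < m %/ 3) c b *: (u b * 'X^(2 * b)).
  rewrite /S mulr_sumr; apply: eq_bigr => b _; rewrite -scalerAr; congr (_ *: _).
  have CE : (- anharmC F) ^+ (2 * b) = 'X^(2 * b) * (1 - 'X) ^+ (2 * b).
    by rewrite exprM sqrrN -exprM /anharmC exprMn.
  rewrite /alt_poly /u /A exprS CE.
  by move: ('X^(2 * b)) ((1 - 'X) ^+ (2 * b)) (_ ^+ (m - 3 - 3 * b)) => p1 p2 p3; ring.
have A0 : A != 0.
  have A3 : A.[3] = - 120 by rewrite /A /anharmC !hornerE /=; ring.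
  by apply/eqP => A0; move/eqP: A3; rewrite A0 horner0 eq_sym oppr_eq0 pnatr_eq0.
have u0 b : (u b)`_0 != 0.
  rewrite -horner_coef0 /u /anharmQ hornerM !horner_exp !hornerE /= subr0 expr1n mul1r.
  by rewrite expr0n addr0 expf_neq0 // oppr_eq0 oner_eq0.
apply/rowP => i; rewrite -cE [RHS]mxE; apply: (triangular_poly_free u0) => //.
by apply: (mulfI A0); rewrite mulr0 -SE.
Qed.

Lemma alternate_sum n (c : nat -> F) (f : nat -> F -> F -> F) x y :
  alternate (fun a b => \sum_(j < n) c j * f j a b) x y =
  \sum_(j < n) c j * alternate (f j) x y.
Proof.
rewrite /alternate; under [RHS]eq_bigr => j _ do rewrite !(mulrDr, mulrN).
by rewrite !big_split /= !sumrN.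
Qed.

Lemma alternate_swap f x y : alternate (fun a b => f b a) x y = - alternate f x y.
Proof. by rewrite /alternate; ring. Qed.

Lemma alternate_reflect f x y :
  alternate (fun a b => f (- a - b) b) x y = - alternate f x y.
Proof.
rewrite /alternate.
have -> : - x - - y = y - x by ring.
have -> : - - y - x = y - x by ring.
have -> : - - y - (y - x) = x by ring.
have -> : - (y - x) - - y = x by ring.
have -> : - (y - x) - x = - y by ring.
have -> : - x - (y - x) = - y by ring.
by ring.
Qed.

Lemma eq_alternate f f' x y : x != 0 -> y != 0 -> y - x != 0 ->
  (forall a b, b != 0 -> f a b = f' a b) -> alternate f x y = alternate f' x y.
Proof.
by move=> x0 y0 yx0 ff'; rewrite /alternate !ff' ?oppr_eq0.
Qed.

(** A lower bound for the rank of [alt_mx]: its row space contains the values of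
    all alternating forms, not only of those obtained from even monomials. Take
    a functional M that factors through [alternate] and kills the even monomials.
    It changes sign under (a,b) -> (b,a) and (a,b) -> (-a-b,b). Expanding the
    second substitution in a^j b^(w-j) gives, both for even and for odd j,
    that the combination of the M(a^l b^(w-l)), l < j, with the binomial
    coefficients C(j,l) is zero. This system is triangular, so M kills every
    monomial. *)
Lemma alt_form_mx_sub : (alt_form_mx <= alt_mx)%MS.
Proof.
rewrite submxE; apply/eqP/matrixP => b0 j0.
set u := cokermx _; pose M f := \sum_(l < w.+1) alternate f (altpoint l) 1 * u l j0.
have M_even_lt j : ~~ odd j -> (j < m)%N -> M (monom2 j) = 0.
  move=> j_even ltj; have lt : (j./2 < uphalf m)%N by lia.
  have /matrixP/(_ (Ordinal lt) j0) := mulmx_coker alt_mx; rewrite !mxE => H.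
  by rewrite -[RHS]H; apply: eq_bigr => l _; rewrite [alt_mx _ _]mxE /= even_halfK.
have eqM f f' : (forall a b, b != 0 -> f a b = f' a b) -> M f = M f'.
  move=> ff'; apply: eq_bigr => l _; congr (_ * _); have [l0 l1] := altpoint_neq0 l.
  by apply: eq_alternate; rewrite ?oner_eq0.
have M_swap f : M (fun a b => f b a) = - M f.
  by rewrite /M -sumrN; apply: eq_bigr => l _; rewrite alternate_swap mulNr.
have M_reflect f : M (fun a b => f (- a - b) b) = - M f.
  by rewrite /M -sumrN; apply: eq_bigr => l _; rewrite alternate_reflect mulNr.
have M_sum n (c : nat -> F) (f : nat -> F -> F -> F) : M (fun a b => \sum_(j < n) c j * f j a b) = \sum_(j < n) c j * M (f j).
  rewrite /M; under eq_bigr => l _ do rewrite alternate_sum mulr_suml.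
  rewrite exchange_big /=; apply: eq_bigr => j _; rewrite mulr_sumr.
  by apply: eq_bigr => l _; rewrite mulrA.
have M_even j : ~~ odd j -> (j <= w)%N -> M (monom2 j) = 0.
  move=> j_even lejw; have [/M_even_lt->//|lemj] := ltnP j m.
  have MC : M (monom2 j) = - M (monom2 (w - j)%N).
    by rewrite -M_swap; apply: eqM => a b _; rewrite monom2C.
  move: lemj; rewrite leq_eqVlt => /predU1P[mj|ltj].
    have wj : (w - j = j)%N by lia.
    rewrite wj in MC; have /eqP : M (monom2 j) *+ 2 = 0 by rewrite mulr2n {1}MC addNr.
    by rewrite mulrn_eq0 => /eqP.
  by rewrite MC M_even_lt ?oppr0 //; [rewrite oddB // oddM /= (negPf j_even)|lia].
(* For odd j the two signs cancel, and the terms M(a^j b^(w-j)) drop out of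
   both sides; for even j these terms are zero. *)
have M_binom j : (j <= w)%N -> \sum_(l < j) 'C(j, l)%:R * M (monom2 l) = 0.
  move=> lejw; apply: (addIr (M (monom2 j))); rewrite add0r.
  have -> : \sum_(l < j) 'C(j, l)%:R * M (monom2 l) + M (monom2 j) =
      \sum_(l < j.+1) 'C(j, l)%:R * M (monom2 l).
    by rewrite big_ord_recr /= binn mul1r.
  rewrite -(M_sum _ (fun l => 'C(j, l)%:R) monom2).
  have -> : M (fun a b => \sum_(l < j.+1) 'C(j, l)%:R * monom2 l a b) =
      M (fun a b => (-1) ^+ j * monom2 j (- a - b) b).
    apply: eqM => a b _; rewrite /monom2.
    have -> : - a - b = - (b + a) by ring.
    rewrite (exprNn (b + a)) mulrA mulrA -expr2 sqrr_sign mul1r exprDn mulr_suml.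
    apply: eq_bigr => l _; rewrite mulr_natl mulrnAl.
    by rewrite [b ^+ _ * _]mulrC -mulrA -exprD addnC addnBA ?subnK // leq_ord.
  have -> : M (fun a b => (-1) ^+ j * monom2 j (- a - b) b) = (-1) ^+ j * - M (monom2 j).
    rewrite -M_reflect /M mulr_sumr; apply: eq_bigr => l _; rewrite mulrA; congr (_ * _).
    by rewrite /alternate; ring.
  have [j_odd|j_even] := boolP (odd j); last by rewrite M_even // oppr0 mulr0.
  by rewrite -signr_odd j_odd expr1 mulN1r opprK.
have M0 j : (j <= w)%N -> M (monom2 j) = 0.
  elim/ltn_ind: j => j IHj; rewrite leq_eqVlt => /predU1P[->|ltj].
    by apply: M_even; rewrite ?oddM.
  have := M_binom j.+1 ltj; rewrite big_ord_recr /= big1 ?add0r => [|l _].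
    by rewrite binSn => /eqP; rewrite mulf_eq0 pnatr_eq0 => /eqP.
  by rewrite IHj ?mulr0 //; apply: ltnW; apply: ltn_trans ltj.
have [P PE] := alt_form_coef (ltn_ord b0).
have MP : M (alt_form b0) = 0.
  rewrite (eqM _ _ PE) M_sum big1 // => j _; by rewrite M0 ?mulr0 // leq_ord.
rewrite !mxE; apply: (@mulfI _ 6); first by rewrite pnatr_eq0.
rewrite mulr0 -[RHS]MP mulr_sumr; apply: eq_bigr => l _.
by rewrite mxE alternate_alt_form mulrA.
Qed.

(** The even coefficients of index below m determine an even period polynomial and
    form a vector in the kernel of [alt_mx], which has dimension at most
    uphalf m - m / 3 by [alt_form_mx_sub]. So this many independent even period
    polynomials span. *)
Lemma even_period_span (r : nat) (Bs : 'I_r -> nat -> F) :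
  r = (uphalf m - m %/ 3)%N -> (forall i, even_period (Bs i)) ->
  (forall c : 'I_r -> F,
     (forall j, (j <= w)%N -> \sum_i c i * Bs i j = 0) -> forall i, c i = 0) ->
  forall P, even_period P ->
  exists c : 'I_r -> F, forall j, (j <= w)%N -> P j = \sum_i c i * Bs i j.
Proof.
move=> rE BsW Bs_free P PW.
pose BM : 'M[F]_(r, uphalf m) := \matrix_i half_coef (Bs i).
(* Antisymmetry gives the coefficients of index above m and makes the middle
   one vanish. *)
have determined (Q Q' : nat -> F) : even_period Q -> (forall j, (j <= w)%N -> Q' j = - Q' (w - j)%N) ->
    (forall j, odd j -> (j <= w)%N -> Q' j = 0) ->
    (forall i : 'I_(uphalf m), Q i.*2 = Q' i.*2) -> forall j, (j <= w)%N -> Q j = Q' j.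
  move=> QW Q'anti Q'odd QQ' j lejw.
  have [j_odd|j_even] := boolP (odd j); first by rewrite even_period_even // Q'odd.
  have low k : ~~ odd k -> (k < m)%N -> Q k = Q' k.
    move=> k_even ltk; have lt : (k./2 < uphalf m)%N by lia.
    by have := QQ' (Ordinal lt); rewrite /= even_halfK.
  have [ltj|] := ltnP j m; first exact: low.
  rewrite leq_eqVlt => /predU1P[mj|ltj].
    have mid (u : F) : u = - u -> u = 0.
      move=> uu; have /eqP : u *+ 2 = 0 by rewrite mulr2n {1}uu addNr.
      by rewrite mulrn_eq0 => /eqP.
    have -> : Q j = 0.
      by apply: mid; rewrite {1}(even_period_anti QW lejw) -mj; congr (- Q _); lia.
    by symmetry; apply: mid; rewrite {1}(Q'anti _ lejw) -mj; congr (- Q' _); lia.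
  rewrite (even_period_anti QW lejw) Q'anti // low //; last by lia.
  by rewrite oddB // oddM /= (negPf j_even).
have comb_anti (c : 'I_r -> F) j : (j <= w)%N ->
    \sum_i c i * Bs i j = - \sum_i c i * Bs i (w - j)%N.
  move=> lejw; rewrite -sumrN; apply: eq_bigr => i _.
  by rewrite (even_period_anti (BsW i) lejw) mulrN.
have comb_odd (c : 'I_r -> F) j : odd j -> (j <= w)%N -> \sum_i c i * Bs i j = 0.
  by move=> jo lejw; rewrite big1 // => i _; rewrite even_period_even ?mulr0.
have zeroW : even_period (fun _ => 0).
  have f0 a b : form (fun _ => 0) a b = 0 by rewrite /form big1 // => j _; rewrite mul0r.
  by split=> a b; rewrite !f0 ?oppr0 ?addr0.
have BM_free : row_free BM.
  apply: inj_row_free => v vBM; apply/rowP => i; rewrite [RHS]mxE.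
  apply: (Bs_free (fun i => v 0 i)) => j lejw; symmetry; move: j lejw.
  apply: determined => // [j|j|i']; [exact: comb_anti|exact: comb_odd|].
  transitivity ((v *m BM) 0 i'); first by rewrite vBM mxE.
  by rewrite mxE; apply: eq_bigr => i'' _; rewrite !mxE.
have BM_ker : (BM <= kermx alt_mx)%MS.
  apply/sub_kermxP/row_matrixP => i; rewrite row_mul rowK row0.
  exact: half_coef_ker.
have ker_BM : (kermx alt_mx <= BM)%MS.
  have [_ <-] := mxrank_leqif_sup BM_ker; rewrite (eqP BM_free) mxrank_ker rE.
  apply/eqP/anti_leq/andP; split.
    by rewrite -rE -mxrank_ker -(eqP BM_free) mxrankS.
  by apply: leq_sub2l; rewrite -(eqP alt_form_mx_free); apply: mxrankS alt_form_mx_sub.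
have /submxP[c cE] : (half_coef P <= BM)%MS.
  by apply: submx_trans ker_BM; apply/sub_kermxP; apply: half_coef_ker.
exists (fun i => c 0 i); apply: determined => // [j|j|i]; [exact: comb_anti|exact: comb_odd|].
have /rowP/(_ i) := cE; rewrite !mxE => ->.
by apply: eq_bigr => i'' _; rewrite !mxE.
Qed.
End PeriodPolynomials.

(** * Sums over the modular group *)

Definition mx22 (T : Type) (a b c d : T) : 'M[T]_2 :=
  \matrix_(i, j) if i == 0 then if j == 0 then a else b else if j == 0 then c else d.

Lemma mx22E (T : Type) (g : 'M[T]_2) : g = mx22 (g 0 0) (g 0 1) (g 1 0) (g 1 1).
Proof.
have I2 (l : 'I_2) : l = 0 \/ l = 1.
  by case: l => [[|[|//]]] l2; [left|right]; apply: val_inj.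
by apply/matrixP => i j; rewrite mxE; case: (I2 i) => ->; case: (I2 j) => ->.
Qed.

Lemma mx22_inj (T : Type) (a b c d a' b' c' d' : T) :
  mx22 a b c d = mx22 a' b' c' d' -> [/\ a = a', b = b', c = c' & d = d'].
Proof.
move=> /matrixP E; have := (E 0 0, E 0 1, E 1 0, E 1 1).
by rewrite !mxE /= => -[[[]]].
Qed.

Lemma det_mx22 (T : comNzRingType) (g : 'M[T]_2) :
  \det g = g 0 0 * g 1 1 - g 0 1 * g 1 0.
Proof.
rewrite (expand_det_row _ 0) big_ord_recl big_ord1 /cofactor !det_mx11 !mxE.
rewrite !(mul1r, expr0) /= expr1 mulN1r mulrN.
by congr (g _ _ * g _ _ - g _ _ * g _ _); apply: val_inj.
Qed.

Definition SL2Z : set 'M[int]_2 := [set g | \det g = 1].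

Section GammaSum.
Variable R : realType.
Variables n' n : nat.
Hypotheses (n'_odd : odd n') (n_odd : odd n).

(** [Gamma_term] in integers, and extended by 0 outside [Gamma_range], so that
    sums run over all of SL2(Z) and can be reindexed freely. As n and n' are odd,
    sgn(k/h + b/a) u^n' v^n = sgn(a u) sgn(u) sgn(v) |u|^n' |v|^n
    = sgn(a v) |u|^n' |v|^n. *)
Definition crossing (a b c d h k : int) : int :=
  let u := a * k + b * h in let v := c * k + d * h in
  if a * c * (u * v) < 0 then Num.sg (a * v) * `|u| ^+ n' * `|v| ^+ n else 0.

Definition crossing_mx (h k : int) (g : 'M[int]_2) : int :=
  crossing (g 0 0) (g 0 1) (g 1 0) (g 1 1) h k.

Definition crossing_sum (h k : int) : R :=
  \sum_(g \in SL2Z) ((crossing_mx h k g)%:~R : R).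

Lemma crossing_reindex (h k : int) (f f' : 'M[int]_2 -> 'M[int]_2) :
  cancel f f' -> (forall g, \det (f g) = \det g) -> (forall g, \det (f' g) = \det g) ->
  cancel f' f ->
  crossing_sum h k = \sum_(g \in SL2Z) ((crossing_mx h k (f g))%:~R : R).
Proof.
move=> fK det_f det_f' f'K; apply: reindex_fsbig; split.
- by move=> g; rewrite /SL2Z /= det_f.
- by move=> g g' _ _; apply: can_inj fK g g'.
by move=> g g1; exists (f' g); rewrite ?f'K //= /SL2Z /= det_f'.
Qed.

Lemma sgr_exp_odd (x : int) j : odd j -> x ^+ j = Num.sg x * `|x| ^+ j.
Proof.
move=> j_odd; rewrite {1}[x]numEsg exprMn -[in X in X * _](odd_double_half j) j_odd.
rewrite exprD expr1 -mul2n exprM.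
have [->|x0] := eqVneq x 0; first by rewrite sgr0 !mul0r.
by rewrite sqr_sg x0 expr1n mulr1.
Qed.

Lemma Gamma_rangeE (h : {posnum int}) (k : int) g :
  Gamma_range R h k g <-> SL2Z g /\
   g 0 0 * g 1 0 * ((g 0 0 * k + g 0 1 * h%:num) * (g 1 0 * k + g 1 1 * h%:num)) < 0.
Proof.
rewrite /Gamma_range /SL2Z /=.
set a := g 0 0; set b := g 0 1; set c := g 1 0; set d := g 1 1.
set H : int := h%:num; have H0 : 0 < H by rewrite /H gt0.
have HR : H%:~R != 0 :> R by rewrite intr_eq0 gt_eqF.
have E (a0 : a != 0) (c0 : c != 0) :
    (k%:~R / H%:~R + b%:~R / a%:~R) * (k%:~R / H%:~R + d%:~R / c%:~R) *
      (H%:~R * a%:~R * c%:~R) ^+ 2 = (a * c * ((a * k + b * H) * (c * k + d * H)))%:~R :> R.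
  have aR : a%:~R != 0 :> R by rewrite intr_eq0.
  have cR : c%:~R != 0 :> R by rewrite intr_eq0.
  by rewrite !(intrM, intrD); field; rewrite aR cR HR.
have sqp (a0 : a != 0) (c0 : c != 0) : 0 < (H%:~R * a%:~R * c%:~R) ^+ 2 :> R.
  by rewrite exprn_even_gt0 //= !mulf_neq0 ?HR ?intr_eq0.
split.
  case=> -> ac0; move: (ac0); rewrite mulf_eq0 negb_or => /andP[a0 c0] neg.
  by split=> //; rewrite -(ltr_int R) -E // pmulr_llt0 // sqp.
case=> -> neg; have ac0 : a * c != 0.
  by apply: contraTneq neg => ->; rewrite mul0r ltxx.
move: (ac0); rewrite mulf_eq0 negb_or => /andP[a0 c0].
split=> //; [by rewrite a0 c0|by rewrite -(pmulr_llt0 _ (sqp a0 c0)) E // ltrz0].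
Qed.

Lemma sum_Gamma_term w (h : {posnum int}) (k : int) : w = (n' + n)%N ->
  \sum_(g \in Gamma_range R h k) Gamma_term R w n h k g = crossing_sum h%:num k.
Proof.
move=> wE; rewrite /crossing_sum.
transitivity (\sum_(g \in Gamma_range R h k) ((crossing_mx h%:num k g)%:~R : R)).
  apply: eq_fsbigr => g; rewrite inE => /Gamma_rangeE[_ neg].
  rewrite /crossing_mx /crossing neg /Gamma_term.
  move: neg; set a := g 0 0; set b := g 0 1; set c := g 1 0; set d := g 1 1.
  set H : int := h%:num; set u := a * k + b * H; set v := c * k + d * H => neg.
  have a0 : a != 0 by apply: contraTneq neg => ->; rewrite !mul0r ltxx.
  have H0 : 0 < H by rewrite /H gt0.
  have -> : k%:~R / H%:~R + b%:~R / a%:~R = (u * a)%:~R / (H%:~R * a%:~R ^+ 2) :> R.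
    by rewrite /u !(intrM, intrD); field; rewrite !intr_eq0 a0 gt_eqF.
  rewrite sgrM sgrV [Num.sg (_ * _ ^+ 2)]gtr0_sg ?invr1; last first.
    by rewrite mulr_gt0 ?ltr0z // exprn_even_gt0 //= intr_eq0.
  rewrite mulr1 wE addnK; have -> : Num.sg ((u * a)%:~R : R) = (Num.sg (u * a))%:~R.
    by rewrite sgrEz sgz_int -sgrz.
  transitivity ((Num.sg (u * a) * u ^+ n' * v ^+ n)%:~R : R).
    by rewrite !intrM !rmorphXn.
  congr (_%:~R).
  rewrite (sgr_exp_odd u) // (sgr_exp_odd v) // !sgrM.
  have u0 : u != 0 by apply: contraTneq neg => ->; rewrite mul0r mulr0 ltxx.
  have su : Num.sg u * Num.sg u = 1 by rewrite -expr2 sqr_sg u0.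
  transitivity ((Num.sg u * Num.sg u) * (Num.sg a * Num.sg v * `|u| ^+ n' * `|v| ^+ n)).
    by ring.
  by rewrite su mul1r.
apply: fsbig_widen.
  by move=> g /Gamma_rangeE[].
move=> g [g1 /= /Gamma_rangeE ngR].
rewrite /crossing_mx /crossing; case: ifP => // neg; case: ngR.
by split.
Qed.

Lemma crossing_sum_period h k : crossing_sum h (k + h) = crossing_sum h k.
Proof.
pose f (s : int) (g : 'M[int]_2) := mx22 (g 0 0) (g 0 1 + s * g 0 0) (g 1 0) (g 1 1 + s * g 1 0).
have fK s : cancel (f s) (f (- s)).
  by move=> g; rewrite [RHS]mx22E /f !mxE /=; congr mx22; ring.
have det_f s g : \det (f s g) = \det g by rewrite !det_mx22 !mxE /=; ring.
rewrite (crossing_reindex h (k + h) (fK (-1)) (det_f _) (det_f _) (fK 1)).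
apply: eq_fsbigr => g _; rewrite /crossing_mx /crossing !mxE /=; congr (_%:~R).
have -> : g 0 0 * (k + h) + (g 0 1 + -1 * g 0 0) * h = g 0 0 * k + g 0 1 * h by ring.
by have -> : g 1 0 * (k + h) + (g 1 1 + -1 * g 1 0) * h = g 1 0 * k + g 1 1 * h by ring.
Qed.

Lemma crossing_sum_opp h k : crossing_sum h (- k) = crossing_sum h k.
Proof.
pose f (g : 'M[int]_2) := mx22 (g 0 0) (- g 0 1) (- g 1 0) (g 1 1).
have fK : cancel f f by move=> g; rewrite [RHS]mx22E /f !mxE /= !opprK.
have det_f g : \det (f g) = \det g by rewrite !det_mx22 !mxE /=; ring.
rewrite (crossing_reindex h (- k) fK det_f det_f fK).
apply: eq_fsbigr => g _; rewrite /crossing_mx /crossing !mxE /=; congr (_%:~R).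
have -> : g 0 0 * - k + - g 0 1 * h = - (g 0 0 * k + g 0 1 * h) by ring.
have -> : - g 1 0 * - k + g 1 1 * h = g 1 0 * k + g 1 1 * h by ring.
by rewrite !(mulrN, mulNr) opprK normrN.
Qed.

Lemma crossing_sum_scale (c : int) h k : 0 < c ->
  crossing_sum (c * h) (c * k) = c%:~R ^+ (n' + n) * crossing_sum h k.
Proof.
move=> c0; rewrite /crossing_sum mulr_fsumr; apply: eq_fsbigr => g _.
rewrite -rmorphXn -rmorphM /=; congr (_%:~R); rewrite /crossing_mx /crossing.
set a := g 0 0; set b := g 0 1; set c' := g 1 0; set d := g 1 1.
have -> : a * (c * k) + b * (c * h) = c * (a * k + b * h) by ring.
have -> : c' * (c * k) + d * (c * h) = c * (c' * k + d * h) by ring.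
set u := a * k + b * h; set v := c' * k + d * h.
have -> : a * c' * (c * u * (c * v)) = c ^+ 2 * (a * c' * (u * v)) by ring.
rewrite pmulr_rlt0 ?exprn_gt0 //; case: ifP => _; last by rewrite mulr0.
rewrite mulrCA sgrM (gtr0_sg c0) mul1r !normrM (gtr0_norm c0) !exprMn exprD; ring.
Qed.

(** Right multiplication by the quarter turn. *)
Definition turn (g : 'M[int]_2) := mx22 (- g 0 1) (g 0 0) (- g 1 1) (g 1 0).

Definition unturn (g : 'M[int]_2) := mx22 (g 0 1) (- g 0 0) (g 1 1) (- g 1 0).

Lemma turnK : cancel turn unturn.
Proof. by move=> g; rewrite [RHS]mx22E /unturn !mxE /= !opprK. Qed.

Lemma det_turn g : \det (turn g) = \det g.
Proof. by rewrite !det_mx22 !mxE /=; ring. Qed.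

(** Up to sign, the term of [turn g] in the sum at (k,-h). *)
Definition crossing_mx' (h k : int) (g : 'M[int]_2) : int :=
  crossing (g 0 1) (g 0 0) (g 1 1) (g 1 0) k h.

Lemma crossing_sum_swap h k :
  crossing_sum k (- h) = - \sum_(g \in SL2Z) ((crossing_mx' h k g)%:~R : R).
Proof.
have f'K : cancel unturn turn by move=> g; rewrite [RHS]mx22E /turn !mxE /= !opprK.
have det_f' g : \det (unturn g) = \det g by rewrite !det_mx22 !mxE /=; ring.
rewrite (crossing_reindex k (- h) turnK det_turn det_f' f'K) -[RHS]mulN1r mulr_fsumr.
apply: eq_fsbigr => g _; rewrite mulN1r -rmorphN /=; congr (_%:~R).
rewrite /crossing_mx /crossing_mx' /crossing !mxE /=.
have -> : - g 0 1 * - h + g 0 0 * k = g 0 1 * h + g 0 0 * k by ring.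
have -> : - g 1 1 * - h + g 1 0 * k = g 1 1 * h + g 1 0 * k by ring.
rewrite mulrNN; case: ifP => _; last by rewrite oppr0.
by rewrite mulNr sgrN !mulNr.
Qed.

Lemma same_sign_lt0 (x y z : int) : 0 < x * y -> (x * z < 0) = (y * z < 0).
Proof.
have [x0|x0|->] := ltgtP x 0; last by rewrite mul0r ltxx.
  by rewrite nmulr_rgt0 // => y0; rewrite !nmulr_rlt0.
by rewrite pmulr_rgt0 // => y0; rewrite !pmulr_rlt0.
Qed.

(** The nonzero integers b c and a d = b c + 1 have the same sign, so that a c and
    b d have the same sign and both terms are subject to the same condition. This
    condition forces a b < 0: otherwise c d > 0 as well, and a u and c v would be
    positive. Hence sgn(a v) and sgn(b v) are opposite. *)
Lemma crossing_cancel a b c d h k : a * d - b * c = 1 -> 0 < h -> 0 < k ->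
  a != 0 -> b != 0 -> c != 0 -> d != 0 ->
  crossing a b c d h k + crossing b a d c k h = 0.
Proof.
move=> det1 h0 k0 a0 b0 c0 d0; rewrite /crossing.
rewrite [b * h + _]addrC [d * h + _]addrC.
set u := a * k + b * h; set v := c * k + d * h.
have abcd : 0 < (a * c) * (b * d).
  have -> : (a * c) * (b * d) = (a * d) * (b * c) by ring.
  have bc0 : b * c != 0 by rewrite mulf_neq0.
  have ad0 : a * d != 0 by rewrite mulf_neq0.
  have -> : a * d = b * c + 1 by rewrite -det1; ring.
  have : b * c + 1 != 0 by rewrite -det1 addrC subrK.
  by move: (b * c) bc0 => x; nia.
rewrite -(same_sign_lt0 (u * v) abcd).
case: ifP => // neg.
have ab : a * b < 0.
  rewrite ltNge; apply/negP => ab_ge0.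
  have ab : 0 < a * b by rewrite lt_neqAle ab_ge0 andbT eq_sym mulf_neq0.
  have cd : 0 < c * d.
    have abcdE : a * c * (b * d) = (a * b) * (c * d) by ring.
    by move: abcd; rewrite abcdE pmulr_rgt0.
  move: neg; have -> : a * c * (u * v) = (a * u) * (c * v) by ring.
  have au : 0 < a * u.
    rewrite /u mulrDr; have -> : a * (a * k) + a * (b * h) = a ^+ 2 * k + (a * b) * h by ring.
    by apply: addr_gt0; apply: mulr_gt0 => //; rewrite exprn_even_gt0.
  have cv : 0 < c * v.
    rewrite /v mulrDr; have -> : c * (c * k) + c * (d * h) = c ^+ 2 * k + (c * d) * h by ring.
    by apply: addr_gt0; apply: mulr_gt0 => //; rewrite exprn_even_gt0.
  by rewrite ltNge mulr_ge0 // ltW.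
have sab : Num.sg a = - Num.sg b.
  have [a_neg|a_pos] := ltrP a 0.
    by move: ab; rewrite nmulr_rlt0 // => b_pos; rewrite ltr0_sg // gtr0_sg.
  have {}a_pos : 0 < a by rewrite lt_neqAle a_pos andbT eq_sym.
  by move: ab; rewrite pmulr_rlt0 // => b_neg; rewrite gtr0_sg // ltr0_sg // opprK.
by rewrite !sgrM sab; ring.
Qed.

Lemma crossing_axis (c h k : int) : 0 < h -> 0 < k -> c * (c * k + h) < 0 ->
  [/\ c < 0, 0 < c * k + h & - c < h].
Proof.
move=> h0 k0 neg.
have c0 : c < 0 by rewrite ltNge; apply/negP => c0; nia.
have ck : 0 < c * k + h by nia.
by split=> //; nia.
Qed.

(** The matrices with a zero entry at which the two terms do not cancel. The first
    boolean is an overall sign, the other two select the vanishing entry. *)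
Definition axis_mx N (i : bool * bool * bool * 'I_N) : 'M[int]_2 :=
  let: (e, s1, s2, j) := i in
  let e : int := if e then 1 else -1 in let J : int := j.+1%:Z in
  match s1, s2 with
  | false, false => mx22 e 0 (- (e * J)) e
  | false, true => mx22 (e * J) (- e) e 0
  | true, false => mx22 0 e (- e) (e * J)
  | true, true => mx22 e (- (e * J)) 0 e
  end.

Lemma axis_mx_inj N : injective (@axis_mx N).
Proof.
move=> [[[e s1] s2] j] [[[e' s1'] s2'] j'] /= E.
suff [-> -> -> /val_inj->] : [/\ e = e', s1 = s1', s2 = s2' & j = j' :> nat] by [].
move: E; rewrite /axis_mx; case: s1; case: s2; case: s1'; case: s2' => E;
  have [] := mx22_inj E; clear E.
all: by case: e; case: e' => *; split=> //; lia.
Qed.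

(** What a matrix of [axis_mx] contributes to the difference of the sums at (h,k)
    and (k,-h). *)
Definition axis_value (h k : int) (s1 s2 : bool) (J : int) : int :=
  match s1, s2 with
  | false, false => if J * k < h then k ^+ n' * (h - J * k) ^+ n else 0
  | false, true => if J * k < h then (h - J * k) ^+ n' * k ^+ n else 0
  | true, false => if J * h < k then - (h ^+ n' * (k - J * h) ^+ n) else 0
  | true, true => if J * h < k then - ((k - J * h) ^+ n' * h ^+ n) else 0
  end.

Lemma crossingN a b c d h k : crossing (- a) (- b) (- c) (- d) h k = crossing a b c d h k.
Proof.
rewrite /crossing.
have -> : - a * k + - b * h = - (a * k + b * h) by ring.
have -> : - c * k + - d * h = - (c * k + d * h) by ring.
by rewrite !mulrNN !normrN.
Qed.

Lemma crossing_eq0 a b c d h k : a * c = 0 -> crossing a b c d h k = 0.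
Proof. by rewrite /crossing => ->; rewrite mul0r ltxx. Qed.

Lemma crossing_axisE1 J h k : 0 < h -> 0 < k -> 0 < J ->
  crossing 1 0 (- J) 1 h k = if J * k < h then k ^+ n' * (h - J * k) ^+ n else 0.
Proof.
move=> h0 k0 J0; rewrite /crossing !mul1r mul0r addr0.
have -> : - J * k + h = h - J * k by ring.
rewrite mulNr oppr_lt0 pmulr_rgt0 // pmulr_rgt0 // subr_gt0.
case: ifP => // lt; have v0 : 0 < h - J * k by rewrite subr_gt0.
by rewrite gtr0_sg // mul1r !gtr0_norm.
Qed.

Lemma crossing_axisE2 J h k : 0 < h -> 0 < k -> 0 < J ->
  crossing J (-1) 1 0 h k = if J * k < h then (h - J * k) ^+ n' * k ^+ n else 0.
Proof.
move=> h0 k0 J0; rewrite /crossing !mul1r mul0r addr0 mulr1 mulN1r.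
rewrite pmulr_rlt0 // pmulr_llt0 // subr_lt0.
case: ifP => // lt; have v0 : 0 < h - J * k by rewrite subr_gt0.
by rewrite gtr0_sg ?mulr_gt0 // mul1r -[X in `|X|]opprB normrN !gtr0_norm.
Qed.

Lemma crossing_axis_mx h k N e s1 s2 (j : 'I_N) : 0 < h -> 0 < k ->
  let g := axis_mx (e, s1, s2, j) in
  crossing_mx h k g + crossing_mx' h k g = axis_value h k s1 s2 j.+1.
Proof.
move=> h0 k0 g; rewrite {}/g /crossing_mx /crossing_mx' /axis_mx /axis_value.
have : 0 < j.+1%:Z by [].
move: j.+1%:Z => J J0.
have crossingE1 : crossing 1 0 J (-1) k h = if J * h < k then - (h ^+ n' * (k - J * h) ^+ n) else 0.
  rewrite /crossing !mul1r mul0r addr0 mulN1r.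
  rewrite pmulr_rlt0 // pmulr_rlt0 // subr_lt0.
  case: ifP => // lt; have v0 : 0 < k - J * h by rewrite subr_gt0.
  by rewrite -[J * h - k]opprB normrN ltr0_sg ?oppr_lt0 // !gtr0_norm // mulN1r mulNr.
have crossingE2 : crossing (- J) 1 1 0 k h = if J * h < k then - ((k - J * h) ^+ n' * h ^+ n) else 0.
  rewrite /crossing !mul1r mul0r addr0 mulr1.
  have -> : - J * h + k = k - J * h by ring.
  rewrite mulNr oppr_lt0 pmulr_rgt0 // pmulr_lgt0 // subr_gt0.
  case: ifP => // lt; have v0 : 0 < k - J * h by rewrite subr_gt0.
  by rewrite mulNr ltr0_sg ?oppr_lt0 ?mulr_gt0 // !gtr0_norm // mulN1r mulNr.
case: e; case: s1; case: s2; rewrite !mxE /= ?mul1r ?mulN1r ?opprK.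
- by rewrite crossing_eq0 ?mulr0 // add0r crossingE2.
- by rewrite crossing_eq0 ?mul0r // add0r crossingE1.
- by rewrite crossing_axisE2 // [crossing (-1) _ _ _ _ _]crossing_eq0 ?mulr0 ?addr0.
- by rewrite crossing_axisE1 // [crossing 0 _ _ _ _ _]crossing_eq0 ?mul0r ?addr0.
- rewrite crossing_eq0 ?mulr0 // add0r -crossingN opprK oppr0; exact: crossingE2.
- rewrite crossing_eq0 ?mul0r // add0r -crossingN !opprK oppr0; exact: crossingE1.
- rewrite [crossing 1 _ _ _ _ _]crossing_eq0 ?mulr0 ?addr0 // -crossingN !opprK oppr0.
  exact: crossing_axisE2.
rewrite [crossing 0 _ _ _ _ _]crossing_eq0 ?mul0r ?addr0 // -crossingN !opprK oppr0.
exact: crossing_axisE1.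
Qed.

Lemma intM_eq1 (x y : int) : x * y = 1 -> exists e : bool,
  x = (if e then 1 else -1) /\ y = (if e then 1 else -1).
Proof.
move=> xy; have : (`|x| * `|y| = 1)%N by rewrite -abszM xy.
move/eqP; rewrite muln_eq1 => /andP[/eqP x1 /eqP y1].
by exists (0 < x); case: ifP => x0; nia.
Qed.

Lemma crossing_neq0 a b c d h k : crossing a b c d h k != 0 ->
  a * c * ((a * k + b * h) * (c * k + d * h)) < 0.
Proof. by rewrite /crossing; case: ifP => //; rewrite eqxx. Qed.

(** The conditions J k < h and J h < k bound the free entry, so that finitely many
    matrices remain. *)
Lemma crossing_support h k N (g : 'M[int]_2) : 0 < h -> 0 < k ->
  h <= N%:Z -> k <= N%:Z -> SL2Z g ->
  crossing_mx h k g + crossing_mx' h k g != 0 -> exists i, g = @axis_mx N i.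
Proof.
move=> h0 k0 hN kN; rewrite [g]mx22E; move: (g 0 0) (g 0 1) (g 1 0) (g 1 1) => a b c d.
rewrite /SL2Z /= det_mx22 /crossing_mx /crossing_mx' !mxE /= => det1 nz.
have index J : 0 < J -> J <= N%:Z -> exists j : 'I_N, J = j.+1%:Z.
  move=> J0 JN; have lt : (`|J|.-1 < N)%N by lia.
  by exists (Ordinal lt) => /=; lia.
have sgnK (e : bool) (x : int) :
    x = (if e then 1 else -1) * ((if e then 1 else -1) * x) by case: e; ring.
have [a0|a0] := eqVneq a 0.
  subst a; have [e [bE cE]] : exists e : bool, b = (if e then 1 else -1) /\ - c = (if e then 1 else -1).
    by apply: intM_eq1; rewrite mulrN -det1; ring.
  move: nz; rewrite crossing_eq0 ?mul0r // add0r => /crossing_neq0 neg.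
  pose J := (if e then 1 else -1) * d.
  have negJ : - J * (- J * h + k) < 0.
    rewrite -(pmulr_rlt0 _ h0); move: neg; rewrite -[c]opprK cE bE /J.
    by case: (e); congr (_ < 0); ring.
  have [J0 _ Jk] := crossing_axis k0 h0 negJ.
  have [j jE] : exists j : 'I_N, J = j.+1%:Z by apply: index; lia.
  exists (e, true, false, j); rewrite /axis_mx -jE /J bE.
  by congr mx22; [rewrite -[c]opprK cE | rewrite -sgnK].
have [b0|b0] := eqVneq b 0.
  subst b; have [e [aE dE]] : exists e : bool, a = (if e then 1 else -1) /\ d = (if e then 1 else -1).
    by apply: intM_eq1; rewrite -det1; ring.
  move: nz; rewrite addrC crossing_eq0 ?mul0r // add0r => /crossing_neq0 neg.
  pose J := - ((if e then 1 else -1) * c).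
  have negJ : - J * (- J * k + h) < 0.
    rewrite -(pmulr_rlt0 _ k0); move: neg; rewrite aE dE /J.
    by case: (e); congr (_ < 0); ring.
  have [J0 _ Jk] := crossing_axis h0 k0 negJ.
  have [j jE] : exists j : 'I_N, J = j.+1%:Z by apply: index; lia.
  exists (e, false, false, j); rewrite /axis_mx -jE /J aE dE.
  by congr mx22; rewrite mulrN opprK -sgnK.
have [c0|c0] := eqVneq c 0.
  subst c; have [e [aE dE]] : exists e : bool, a = (if e then 1 else -1) /\ d = (if e then 1 else -1).
    by apply: intM_eq1; rewrite -det1; ring.
  move: nz; rewrite crossing_eq0 ?mulr0 // add0r => /crossing_neq0 neg.
  pose J := - ((if e then 1 else -1) * b).
  have negJ : - J * (- J * h + k) < 0.
    rewrite -(pmulr_rlt0 _ h0); move: neg; rewrite aE dE /J.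
    by case: (e); congr (_ < 0); ring.
  have [J0 _ Jk] := crossing_axis k0 h0 negJ.
  have [j jE] : exists j : 'I_N, J = j.+1%:Z by apply: index; lia.
  exists (e, true, true, j); rewrite /axis_mx -jE /J aE dE.
  by congr mx22; rewrite mulrN opprK -sgnK.
have [d0|d0] := eqVneq d 0.
  subst d; have [e [cE bE]] : exists e : bool, c = (if e then 1 else -1) /\ - b = (if e then 1 else -1).
    by apply: intM_eq1; rewrite -det1; ring.
  move: nz; rewrite addrC crossing_eq0 ?mulr0 // add0r => /crossing_neq0 neg.
  pose J := (if e then 1 else -1) * a.
  have negJ : - J * (- J * k + h) < 0.
    rewrite -(pmulr_rlt0 _ k0); move: neg; rewrite -[b]opprK cE bE /J.
    by case: (e); congr (_ < 0); ring.
  have [J0 _ Jk] := crossing_axis h0 k0 negJ.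
  have [j jE] : exists j : 'I_N, J = j.+1%:Z by apply: index; lia.
  exists (e, false, true, j); rewrite /axis_mx -jE /J cE.
  by congr mx22; [rewrite -sgnK | rewrite -[b]opprK bE].
by move: nz; rewrite crossing_cancel // eqxx.
Qed.

(** A matrix and its opposite contribute equally, which gives the factor 2. *)
Lemma crossing_sum_reciprocity (h k : {posnum int}) N :
  h%:num <= N%:Z -> k%:num <= N%:Z ->
  crossing_sum h%:num k%:num - crossing_sum k%:num (- h%:num) =
  (\sum_(j < N) (axis_value h%:num k%:num false false j.+1
               + axis_value h%:num k%:num false true j.+1
               + axis_value h%:num k%:num true false j.+1
               + axis_value h%:num k%:num true true j.+1))%:~R *+ 2.
Proof.
move=> hN kN; set H : int := h%:num; set K : int := k%:num.
have H0 : 0 < H by rewrite /H gt0.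
have K0 : 0 < K by rewrite /K gt0.
rewrite crossing_sum_swap opprK /crossing_sum.
(* Both sums have finite support, hence may be added term by term. *)
pose D := [set g | crossing_mx H K g != 0] `|` [set g | crossing_mx' H K g != 0].
have D1 : finite_set (SL2Z `&` [set g | crossing_mx H K g != 0]).
  apply: (@sub_finite_set _ _ (Gamma_range R h K)); last exact: finite_Gamma_range.
  move=> g [g1 /= /crossing_neq0 neg].
  by apply/Gamma_rangeE.
have D2 : finite_set (SL2Z `&` [set g | crossing_mx' H K g != 0]).
  apply: (@sub_finite_set _ _ (unturn @` Gamma_range R k (- H))); last first.
    exact/finite_image/finite_Gamma_range.
  move=> g [g1 /= /crossing_neq0 neg]; exists (turn g); last exact: turnK.
  apply/Gamma_rangeE; split; first by rewrite /SL2Z /= det_turn.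
  by rewrite !mxE /= mulrNN !(mulrN, mulNr) !opprK.
have Dfin : finite_set (SL2Z `&` D) by rewrite setIUr finite_setU.
have toD (f : 'M[int]_2 -> int) : (forall g, f g != 0 -> D g) ->
    \sum_(g \in SL2Z) ((f g)%:~R : R) = \sum_(g \in SL2Z `&` D) ((f g)%:~R : R).
  move=> fD; apply/esym/fsbig_widen; first by move=> g [].
  move=> g [g1 gD] /=; apply/eqP; rewrite intr_eq0; apply/negPn/negP => /fD gD'.
  by apply: gD.
rewrite toD; last by move=> g; left.
rewrite [X in _ + X]toD; last by move=> g; right.
rewrite -fsbig_split //=.
have add g : (crossing_mx H K g)%:~R + (crossing_mx' H K g)%:~R =
  (crossing_mx H K g + crossing_mx' H K g)%:~R :> R by rewrite intrD.
under eq_fsbigr do rewrite add.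
rewrite -(toD (fun g => crossing_mx H K g + crossing_mx' H K g)); last first.
  move=> g; rewrite /D /=; have [->|] := eqVneq (crossing_mx H K g) 0; last by left.
  by rewrite add0r; right.
transitivity (\sum_(g \in range (@axis_mx N)) ((crossing_mx H K g + crossing_mx' H K g)%:~R : R)).
  apply/esym/fsbig_widen.
    move=> g [[[[e s1] s2] j] _ <-]; rewrite /SL2Z /= det_mx22 /axis_mx.
    by case: s1; case: s2; case: e; rewrite !mxE /=; ring.
  move=> g [g1 ng] /=; apply/eqP; rewrite intr_eq0; apply/negPn/negP => gn0.
  by have [i gE] := crossing_support H0 K0 hN kN g1 gn0; apply: ng; exists i.
rewrite fsbig_image; last by move=> i i' _ _; apply: axis_mx_inj.
pose F (i : bool * bool * bool * 'I_N) : R :=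
  (crossing_mx H K (axis_mx i) + crossing_mx' H K (axis_mx i))%:~R.
have -> : \sum_(i \in [set: bool * bool * bool * 'I_N]) F i = \sum_i F i.
  transitivity (\sum_(i <- enum {: bool * bool * bool * 'I_N}) F i); last by rewrite big_enum.
  rewrite [RHS]fsbig_seq ?enum_uniq //; apply: eq_fsbigl.
  by apply/seteqP; split=> i //= _; rewrite mem_enum.
have bigT (T1 T2 : finType) (G : T1 * T2 -> R) : \sum_i G i = \sum_p \sum_j G (p, j).
  by rewrite pair_bigA; apply: eq_bigr => -[].
rewrite !bigT !big_bool /=.
pose V s1 s2 := \sum_(j < N) (axis_value H K s1 s2 j.+1)%:~R : R.
have FV e s1 s2 : \sum_(j < N) F (e, s1, s2, j) = V s1 s2.
  by apply: eq_bigr => j _; rewrite /F crossing_axis_mx.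
rewrite !FV rmorph_sum /=.
under [in RHS]eq_bigr => j _ do rewrite !intrD.
rewrite !big_split /= -/(V false false) -/(V false true) -/(V true false) -/(V true true).
by move: (V false false) (V false true) (V true false) (V true true) => ? ? ? ?; ring.
Qed.
End GammaSum.

(** * Symbols and their reciprocity polynomials *)

Section Symbols.
Variable R : realType.
Variable m : nat.
Local Notation w := (2 * m)%N.
Local Notation C := R[i].
Local Notation cst x := ((x : int)%:~R : C).

(** A coefficient sequence instead of a bivariate polynomial, to make the linear
    algebra of [even_period] available. *)
Definition has_reciprocity (E : symbol R) (P : nat -> C) :=
  forall h k : {posnum int}, E (h, k%:num) - E (k, - h%:num) = form m P (cst h%:num) (cst k%:num).

Lemma polynomial_reciprocity_form (E : symbol R) :
  polynomial_reciprocity w E <-> exists P, has_reciprocity E P.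
Proof.
split=> [[p p_homog Ep]|[P EP]].
  exists (fun j => \sum_(mm <- msupp p | mm ord0 == j :> nat) p@_mm) => h k.
  rewrite Ep mevalE; move: (cst h%:num) (cst k%:num) => a b.
  have mdeg2 mm : mm \in msupp p -> (mm ord0 + mm (lift ord0 ord0) = w)%N.
    move=> mms; rewrite -((dhomogP _ _ _ p_homog) _ mms) /= mdegE.
    by rewrite big_ord_recl big_ord1.
  rewrite /form; under [RHS]eq_bigr => j _ do rewrite mulr_suml.
  rewrite (exchange_big_dep xpredT) //= [LHS]big_seq [RHS]big_seq.
  apply: eq_bigr => mm /mdeg2 mmw.
  have ltm : (mm ord0 < w.+1)%N by lia.
  rewrite (big_pred1 (Ordinal ltm)) => [|j]; last by apply: eq_sym.
  rewrite /monom2 /= big_ord_recl big_ord1 /pair2 /=; congr (_ * (_ * _ ^+ _)).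
  by rewrite -mmw addKn.
pose mon j : 'X_{1..2} := [multinom (if i == ord0 then j else (w - j)%N) | i < 2].
exists (\sum_(j < w.+1) P j *: 'X_[mon j]).
  apply: rpred_sum => j _; apply: dhomogZ; rewrite dhomogX /= mdegE.
  by rewrite big_ord_recl big_ord1 !mnmE /= subnKC ?leq_ord.
move=> h k; rewrite EP /form raddf_sum /=; apply: eq_bigr => j _.
rewrite mevalZ mevalX big_ord_recl big_ord1 /pair2 !mnmE /=.
by [].
Qed.

Lemma formZ (P : nat -> C) c a b : form m P (c * a) (c * b) = c ^+ w * form m P a b.
Proof.
rewrite /form mulr_sumr; apply: eq_bigr => j _; rewrite /monom2 !exprMn.
have -> : c ^+ w = c ^+ j * c ^+ (w - j) by rewrite -exprD subnKC ?leq_ord.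
by ring.
Qed.

Lemma posz_gt0 n : 0 < n.+1%:Z. Proof. by []. Qed.

Definition posnat (n : nat) : {posnum int} := PosNum (posz_gt0 n).

Lemma symbol_shift (E : symbol R) (h : {posnum int}) k (z : int) : dedekind_symbol w E ->
  E (h, k + z * h%:num) = E (h, k).
Proof.
move=> [per _].
have up j (q : int) : E (h, q + j%:Z * h%:num) = E (h, q).
  elim: j q => [|j IHj] q; first by rewrite mul0r addr0.
  by rewrite -(IHj q) [RHS]per intS mulrDl mul1r addrA addrAC.
case: z => j; first exact: up.
by rewrite -(up j.+1 (k + _)) NegzE mulNr subrK.
Qed.

(** For positive integers a and b periodicity and evenness give
      f(a+b,b) = E(a+b,b) - E(b,a) and f(a,a+b) = E(a,b) - E(a+b,a),
    with E(a+b,b) = E(a+b,-b) = E(a+b,a). It is enough to have this for b = 1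
    and to use homogeneity. *)
Lemma even_period_of_symbol (E : symbol R) P : even_dedekind_space R w E ->
  has_reciprocity E P -> even_period m P.
Proof.
move=> [[dE _] evE] EP.
have fE (h k : {posnum int}) : E (h, k%:num) - E (k, h%:num) =
    form m P (cst h%:num) (cst k%:num) by rewrite -EP evE.
have fnat a b : form m P a.+1%:R b.+1%:R = E (posnat a, b.+1%:Z) - E (posnat b, a.+1%:Z).
  by rewrite -[RHS]/(E (posnat a, (posnat b)%:num) - E (posnat b, (posnat a)%:num)) fE.
have coef_anti j : (j <= w)%N -> P j = - P (w - j)%N.
  apply: (form_nat_inj (P' := fun j => - P (w - j)%N)) => -[//|a] _.
  have := fnat a 0; rewrite -opprB -fnat => ->.
  rewrite /form (reindex_inj rev_ord_inj) /= -sumrN; apply: eq_bigr => i _.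
  by rewrite subSS mulNr [in RHS]monom2C ?leq_ord.
have anti a b : form m P a b = - form m P b a.
  rewrite /form (reindex_inj rev_ord_inj) /= -sumrN; apply: eq_bigr => i _.
  by rewrite subSS [in RHS]coef_anti ?leq_ord // mulNr opprK [in RHS]monom2C ?leq_ord.
split=> // a b.
have [->|b0] := eqVneq b 0.
  have diag : form m P a a = 0.
    have /eqP : form m P a a *+ 2 = 0 by rewrite mulr2n {1}anti addNr.
    by rewrite mulrn_eq0 => /eqP.
  by rewrite addr0 diag addr0.
pose L : {poly C} := \sum_(j < w.+1) P j *: (('X + 1) ^+ j + 'X^j * ('X + 1) ^+ (w - j) - 'X^j).
have LE x : L.[x] = form m P (x + 1) 1 + form m P x (x + 1) - form m P x 1.
  rewrite /L horner_sum /form -big_split /= -sumrB; apply: eq_bigr => j _.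
  by rewrite /monom2 !expr1n !hornerE /= !mulr1; ring.
have L0 : L = 0.
  apply: (@eq_poly_horner_nat _ _ _ 0) => -[//|n] _; rewrite horner0 LE natr1.
  rewrite -[1]/(1%:R) !fnat.
  have -> : E (posnat n.+1, 1%:Z) = E (posnat n.+1, n.+1%:Z).
    rewrite -evE -(symbol_shift (posnat n.+1) (- 1%:Z) 1 dE); congr (E (_, _)).
    by rewrite /=; lia.
  have -> : E (posnat n, n.+2%:Z) = E (posnat n, 1%:Z).
    rewrite -[RHS](symbol_shift (posnat n) 1%:Z 1 dE); congr (E (_, _)).
    by rewrite /=; lia.
  have -> : E (posnat 0, n.+2%:Z) = E (posnat 0, n.+1%:Z).
    rewrite -[RHS](symbol_shift (posnat 0) n.+1%:Z 1 dE); congr (E (_, _)).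
    by rewrite /=; lia.
  by ring.
have lewis1 : form m P (a / b + 1) 1 + form m P (a / b) (a / b + 1) = form m P (a / b) 1.
  by apply/eqP; rewrite -subr_eq0 -LE L0 horner0.
have aE : b * (a / b) = a by rewrite mulrC divfK.
have abE : b * (a / b + 1) = a + b by rewrite mulrDr aE mulr1.
have := congr1 (fun z => b ^+ w * z) lewis1.
by rewrite /= mulrDr -!formZ abE aE mulr1.
Qed.

(** The Euclidean algorithm: k is reduced modulo h by periodicity, and then h and
    k are exchanged by the reciprocity law, until (h,k) becomes (gcd,0). *)
Lemma symbG_unique (E : symbol R) : dedekind_symbol w E ->
  (forall h k : {posnum int}, E (h, k%:num) = E (k, - h%:num)) ->
  E = E (posnat 0, 0) *: symbG R w.
Proof.
move=> dE recE; have [per hom] := dE.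
have E0 (h : {posnum int}) : E (h, 0) = (cst h%:num) ^+ w * E (posnat 0, 0).
  rewrite -hom; congr (E (_, _)); last by rewrite mulr0.
  by apply: val_inj; rewrite /= mulr1.
have main N (h : {posnum int}) k : (`|h%:num| <= N)%N ->
    E (h, k) = cst (gcdz h%:num k) ^+ w * E (posnat 0, 0).
  elim: N h k => [|N IHN] h k hN; have h0 : 0 < h%:num by rewrite gt0.
    by lia.
  set r := (k %% h%:num)%Z; have kE : k = r + (k %/ h%:num)%Z * h%:num by rewrite addrC -divz_eq.
  have r0 : 0 <= r by rewrite modz_ge0 // gt_eqF.
  have rh : r < h%:num by rewrite ltz_pmod.
  rewrite {1}kE symbol_shift // -gcdz_modr -/r.
  have [->|r_neq0] := eqVneq r 0; first by rewrite gcdz0 gez0_abs ?ltW.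
  have r_pos : 0 < r by rewrite lt_neqAle eq_sym r_neq0.
  have := recE h (PosNum r_pos); rewrite /= => ->.
  by rewrite IHN /= ?gcdzN 1?gcdzC //; lia.
apply/funext => -[h k]; rewrite (main `|h%:num|%N) // /symbG /=.
by rewrite [RHS]mulrC.
Qed.
End Symbols.

(** * Periodic Bernoulli functions *)

Section PeriodicBernoulli.
Variable R : realType.
Local Notation B := (bernpoly R).

Lemma bernper_shift l (x : R) (z : int) : bernper l (x + z%:~R) = bernper l x.
Proof. by rewrite /bernper floorDrz ?intr_int // intrKfloor intrD; congr (horner _ _); ring. Qed.

Lemma bernper_opp l (x : R) : ~~ odd l -> bernper l (- x) = bernper l x.
Proof.
move=> l_even; have refl := poly_comp_1subX _ (bernpoly_refl R l_even).
pose r := x - (Num.floor x)%:~R.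
have xE : x = r + (Num.floor x)%:~R by rewrite subrK.
have r0 : 0 <= r by rewrite subr_ge0 floor_le.
have r1 : r < 1 by rewrite ltrBlDr addrC -[X in _ + X]/(1%:~R) -intrD floorD1_gt.
rewrite xE opprD -rmorphN /= !bernper_shift.
have [->|rn0] := eqVneq r 0; first by rewrite oppr0.
have fr : Num.floor r = 0 by apply: floor_def; rewrite r0 add0r.
have frN : Num.floor (- r) = -1.
  by apply: floor_def; rewrite addNr; apply/andP; split; [lra|rewrite oppr_lt0 lt_neqAle eq_sym rn0].
by rewrite /bernper fr frN subr0 rmorphN1 opprK addrC refl.
Qed.

(** Telescoping with B_{l+1}(x+1) - B_{l+1}(x) = (l+1) x^l, from the fractional
    part of y up to y. *)
Lemma sum_pow_bernper l N (y : R) : (0 < l)%N -> 0 < y -> y <= N%:R ->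
  \sum_(j < N) (if j.+1%:R < y then (y - j.+1%:R) ^+ l else 0) =
  l.+1%:R^-1 * ((B l.+1).[y] - bernper l.+1 y).
Proof.
move=> l0 y0 yN; have [f fE] : exists f : nat, Num.floor y = f.
  by exists `|Num.floor y|%N; rewrite gez0_abs // floor_ge0 ltW.
have fy : f%:R <= y by have := floor_le y; rewrite fE.
have yf : y < f.+1%:R by have := floorD1_gt y; rewrite fE -natr1 intrD.
have fN : (f <= N)%N by rewrite -(ler_nat R) (le_trans fy).
have tel : (B l.+1).[y] - (B l.+1).[y - f%:R] = l.+1%:R * \sum_(j < f) (y - j.+1%:R) ^+ l.
  elim: f {fE fy yf fN} => [|f IHf]; first by rewrite subr0 subrr big_ord0 mulr0.
  rewrite big_ord_recr mulrDr -IHf /=.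
  have -> : y - f%:R = (y - f.+1%:R) + 1 by rewrite -natr1; ring.
  by rewrite horner_bernpoly_shift /=; ring.
rewrite /bernper fE /= -[_%:~R]/(f%:R) tel mulKf ?pnatr_eq0 //.
rewrite (big_ord_widen N (fun j => (y - j.+1%:R) ^+ l) fN) [RHS]big_mkcond /=.
apply: eq_bigr => j _; case: (ltnP j f) => [ltjf|lefj].
  have := le_trans (_ : j.+1%:R <= f%:R) fy; rewrite ler_nat => /(_ ltjf).
  rewrite le_eqVlt => /predU1P[<-|->//].
  by rewrite ltxx subrr expr0n eqn0Ngt l0.
by rewrite ltNge (ltW (lt_le_trans yf _)) // ler_nat ltnS.
Qed.
End PeriodicBernoulli.

(** * The reciprocity law of E_{w,n} *)

Section Reciprocity.
Variable R : realType.
Variables m n : nat.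
Local Notation w := (2 * m)%N.
Local Notation n' := (w - n)%N.
Hypotheses (n_odd : odd n) (ltnw : (n < w)%N).

Let n'_odd : odd n'. Proof. by rewrite oddB ?(ltnW ltnw) // oddM n_odd. Qed.
Let n'n : w = (n' + n)%N. Proof. by rewrite subnK // ltnW. Qed.

Definition bern_pair : {poly R} :=
  n.+1%:R^-1 *: bernpoly R n.+1 + n'.+1%:R^-1 *: bernpoly R n'.+1.

Definition bern_pair_per (x : R) : R :=
  n.+1%:R^-1 * bernper n.+1 x + n'.+1%:R^-1 * bernper n'.+1 x.

Lemma Ewn_realE h k : Ewn_real R w n h k =
  2^-1 * crossing_sum R n' n h%:num k
  + (delta_wn R w n - bern_pair_per (k%:~R / h%:num%:~R)) * h%:num%:~R ^+ w.
Proof.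
rewrite /Ewn_real (sum_Gamma_term R n'_odd n_odd h k n'n).
rewrite -signr_odd n_odd expr1 /bern_pair_per.
by move: (_^-1) (_^-1) => a b; ring.
Qed.

Lemma bern_pair_per_shift x z : bern_pair_per (x + z%:~R) = bern_pair_per x.
Proof. by rewrite /bern_pair_per !bernper_shift. Qed.

Lemma bern_pair_per_opp x : bern_pair_per (- x) = bern_pair_per x.
Proof. by rewrite /bern_pair_per !bernper_opp //= negbK. Qed.

Lemma sum_pow_bern_pair N (y : R) : 0 < y -> y <= N%:R ->
  \sum_(j < N) (if j.+1%:R < y then (y - j.+1%:R) ^+ n + (y - j.+1%:R) ^+ n' else 0) =
  bern_pair.[y] - bern_pair_per y.
Proof.
move=> y0 yN; rewrite /bern_pair hornerD !hornerZ /bern_pair_per opprD addrACA -!mulrBr.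
rewrite -!(sum_pow_bernper _ y0 yN) ?odd_gt0 // -big_split /=.
by apply: eq_bigr => j _; case: ifP; rewrite ?addr0.
Qed.

(** The matrices of [axis_mx] contribute sums of powers of h/k - j and k/h - j,
    which are values of [bern_pair] minus values of its periodic version; the
    latter cancel against the periodic Bernoulli functions in the definition of
    E_{w,n}. *)
Lemma Ewn_real_reciprocity (h k : {posnum int}) :
  Ewn_real R w n h k%:num - Ewn_real R w n k (- h%:num) =
  k%:num%:~R ^+ w * bern_pair.[h%:num%:~R / k%:num%:~R]
  - h%:num%:~R ^+ w * bern_pair.[k%:num%:~R / h%:num%:~R]
  + delta_wn R w n * (h%:num%:~R ^+ w - k%:num%:~R ^+ w).
Proof.
set H : R := h%:num%:~R; set K : R := k%:num%:~R.
have H0 : 0 < H by rewrite ltr0z gt0.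
have K0 : 0 < K by rewrite ltr0z gt0.
have H1 : 1 <= H by rewrite (ler_int R 1) -gtz0_ge1 gt0.
have K1 : 1 <= K by rewrite (ler_int R 1) -gtz0_ge1 gt0.
pose N := (`|h%:num| + `|k%:num|)%N.
have hN : h%:num <= N%:Z by rewrite /N; lia.
have kN : k%:num <= N%:Z by rewrite /N; lia.
have HN : H / K <= N%:R.
  rewrite ler_pdivrMr // (le_trans (_ : H <= N%:R)) ?ler_peMr //.
  by rewrite -(ler_int R) in hN.
have KN : K / H <= N%:R.
  rewrite ler_pdivrMr // (le_trans (_ : K <= N%:R)) ?ler_peMr //.
  by rewrite -(ler_int R) in kN.
rewrite !Ewn_realE rmorphN /= mulNr bern_pair_per_opp -/H -/K.
have -> : forall a b c d : R, 2^-1 * a + c - (2^-1 * b + d) = 2^-1 * (a - b) + c - d.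
  by move=> *; ring.
rewrite (crossing_sum_reciprocity R n'_odd n_odd hN kN).
have axis (x y : int) (X Y : R) (j : nat) : X = x%:~R -> Y = y%:~R -> 0 < Y ->
  (if j.+1%:Z * y < x then y ^+ n' * (x - j.+1%:Z * y) ^+ n else 0)%:~R
  + (if j.+1%:Z * y < x then (x - j.+1%:Z * y) ^+ n' * y ^+ n else 0)%:~R =
  Y ^+ w * (if j.+1%:R < X / Y then (X / Y - j.+1%:R) ^+ n + (X / Y - j.+1%:R) ^+ n' else 0) :> R.
  move=> XE YE Y0.
  have cond : (j.+1%:Z * y < x) = (j.+1%:R < X / Y).
    by rewrite ltr_pdivlMr // XE YE -(ltr_int R) intrM.
  rewrite -cond; case: ifP => _; last by rewrite addr0 mulr0.
  have D : (x - j.+1%:Z * y)%:~R = Y * (X / Y - j.+1%:R) :> R.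
    by rewrite rmorphB /= intrM -XE -YE -[_%:~R]/(j.+1%:R); field; rewrite gt_eqF.
  rewrite !intrM !rmorphXn /= D -YE {3}n'n exprD !exprMn; ring.
rewrite rmorph_sum /=.
have -> : \sum_(j < N) (axis_value n' n h%:num k%:num false false j.+1
    + axis_value n' n h%:num k%:num false true j.+1
    + axis_value n' n h%:num k%:num true false j.+1
    + axis_value n' n h%:num k%:num true true j.+1)%:~R =
    K ^+ w * (bern_pair.[H / K] - bern_pair_per (H / K))
    - H ^+ w * (bern_pair.[K / H] - bern_pair_per (K / H)) :> R.
  rewrite -(sum_pow_bern_pair (divr_gt0 H0 K0) HN) -(sum_pow_bern_pair (divr_gt0 K0 H0) KN).
  rewrite !mulr_sumr -sumrB; apply: eq_bigr => j _.
  rewrite -(axis _ _ _ _ j (erefl H) (erefl K) K0) -(axis _ _ _ _ j (erefl K) (erefl H) H0).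
  rewrite /axis_value !intrD -!addrA; congr (_ + (_ + _)); rewrite opprD.
  by case: ifP => _; rewrite ?rmorphN ?oppr0.
move: (bern_pair_per _) (bern_pair_per _) => p1 p2.
by field.
Qed.
End Reciprocity.

(** * The members of the basis *)

Section Members.
Variable R : realType.
Variable m : nat.
Local Notation w := (2 * m)%N.
Local Notation C := R[i].
Local Notation rc := (real_complex R).

Lemma size_bernpoly (F : numFieldType) l : (size (bernpoly F l) <= l.+1)%N.
Proof.
elim/ltn_ind: l => l IHl; rewrite bernpolyE (leq_trans (size_polyD _ _)) // geq_max.
rewrite size_polyXn leqnn size_polyN (leq_trans (size_scale_leq _ _)) //.
rewrite (leq_trans (size_sum _ _ _)) //; apply/bigmax_leqP => j _.
rewrite -scaler_nat (leq_trans (size_scale_leq _ _)) // (leq_trans (IHl j _)) //.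
by rewrite ltnS ltnW.
Qed.

Lemma size_bern_pair n : (0 < n)%N -> (n < w)%N -> (size (bern_pair R m n) <= w.+1)%N.
Proof.
move=> n0 nw; rewrite (leq_trans (size_polyD _ _)) // geq_max.
rewrite !(leq_trans (size_scale_leq _ _)) ?(leq_trans (size_bernpoly _ _)) //.
by lia.
Qed.

(** The coefficients of h^w - k^w, the reciprocity polynomial of F_w. *)
Definition edge (j : nat) : R := (j == w)%:R - (j == 0)%:R.

Lemma sum_delta j0 (M : nat -> R) : (j0 <= w)%N ->
  \sum_(j < w.+1) ((j : nat) == j0)%:R * M j = M j0.
Proof.
rewrite -ltnS => lt; rewrite (bigD1 (Ordinal lt)) //= eqxx mul1r big1 ?addr0 // => j jj0.
have -> : ((j : nat) == j0) = false by apply: contraNF jj0 => /eqP jE; apply/eqP/val_inj.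
by rewrite mul0r.
Qed.

Lemma form_edge (x y : R) : form m edge x y = x ^+ w - y ^+ w.
Proof.
rewrite /form /edge; under eq_bigr => j _ do rewrite mulrBl.
rewrite sumrB !(sum_delta (fun j => monom2 m j x y)) // /monom2 subnn subn0 !expr0 mulr1 mul1r.
by [].
Qed.

Lemma form_rc (P : nat -> R) x y : form m (fun j => rc (P j)) (rc x) (rc y) = rc (form m P x y).
Proof.
by rewrite /form rmorph_sum; apply: eq_bigr => j _; rewrite /monom2 !rmorphM !rmorphXn.
Qed.

Definition symbE_coef n (j : nat) : R :=
  (bern_pair R m n)`_j - (bern_pair R m n)`_(w - j) + delta_wn R w n * edge j.

Lemma has_reciprocity_symbE n : odd n -> (n < w)%N ->
  has_reciprocity m (symbE R w n) (fun j => rc (symbE_coef n j)).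
Proof.
move=> n_odd nw h k; rewrite /symbE /= -rmorphB (Ewn_real_reciprocity R n_odd nw).
set H : R := h%:num%:~R; set K : R := k%:num%:~R.
have H0 : H != 0 by rewrite intr_eq0 gt_eqF ?gt0.
have K0 : K != 0 by rewrite intr_eq0 gt_eqF ?gt0.
have sz := size_bern_pair (odd_gt0 n_odd) nw.
have eval_form (x y : R) : y != 0 -> y ^+ w * (bern_pair R m n).[x / y] =
    form m (fun j => (bern_pair R m n)`_j) x y.
  move=> y0; rewrite (horner_coef_wide _ sz) mulr_sumr; apply: eq_bigr => j _.
  have -> : y ^+ w = y ^+ (w - j) * y ^+ j by rewrite -exprD subnK ?leq_ord.
  rewrite /monom2 expr_div_n; field; by rewrite expf_neq0.
have -> : (h%:num%:~R : C) = rc H by rewrite rmorph_int.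
have -> : (k%:num%:~R : C) = rc K by rewrite rmorph_int.
rewrite form_rc !eval_form // -form_edge; congr (rc _).
have -> : form m (fun j => (bern_pair R m n)`_j) K H =
    form m (fun j => (bern_pair R m n)`_(w - j)) H K.
  rewrite /form [LHS](reindex_inj rev_ord_inj) /=; apply: eq_bigr => j _.
  by rewrite subSS [monom2 m j H K]monom2C ?leq_ord.
rewrite /form mulr_sumr -sumrB -big_split /=; apply: eq_bigr => j _.
by rewrite /symbE_coef; ring.
Qed.

Lemma dedekind_symbE n : odd n -> (n < w)%N -> dedekind_symbol w (symbE R w n).
Proof.
move=> n_odd nw; split.
  move=> h k; congr (rc _); rewrite /= !(Ewn_realE _ n_odd nw) crossing_sum_period.
  have h0 : h%:num%:~R != 0 :> R by rewrite intr_eq0 gt_eqF ?gt0.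
  have -> : (k + h%:num)%:~R / h%:num%:~R = k%:~R / h%:num%:~R + 1%:~R :> R.
    by rewrite intrD mulrDl divff.
  by rewrite bern_pair_per_shift.
move=> c h k; rewrite /symbE /= !(Ewn_realE _ n_odd nw) /=.
have h0 : h%:num%:~R != 0 :> R by rewrite intr_eq0 gt_eqF ?gt0.
have c0 : c%:num%:~R != 0 :> R by rewrite intr_eq0 gt_eqF ?gt0.
have -> : (c%:num%:~R : C) = rc (c%:num%:~R) by rewrite rmorph_int.
set Y := (X in _ = _ * rc X).
transitivity (rc (c%:num%:~R ^+ w * Y)); last by rewrite rmorphM rmorphXn.
congr (rc _); rewrite {}/Y.
have n'n : (w - n + n = w)%N by rewrite subnK // ltnW.
rewrite crossing_sum_scale ?gt0 // n'n !intrM -mulf_div divff // mul1r exprMn.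
by ring.
Qed.

Lemma even_symbE n : odd n -> (n < w)%N -> even_symbol (symbE R w n).
Proof.
move=> n_odd nw h k; rewrite /symbE /= !(Ewn_realE _ n_odd nw) crossing_sum_opp.
by rewrite rmorphN mulNr bern_pair_per_opp.
Qed.

Lemma mem_symbE n : odd n -> (n < w)%N -> even_dedekind_space R w (symbE R w n).
Proof.
move=> n_odd nw; split; last exact: even_symbE.
split; first exact: dedekind_symbE.
by apply/polynomial_reciprocity_form; eexists; apply: has_reciprocity_symbE.
Qed.

Lemma has_reciprocity_symbF : has_reciprocity m (symbF R w) (fun j => rc (edge j)).
Proof.
move=> h k; rewrite /symbF /=.
have E (z : int) : (z%:~R : C) = rc z%:~R by rewrite rmorph_int.
by rewrite !E form_rc form_edge rmorphB !rmorphXn.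
Qed.

Lemma mem_symbF : even_dedekind_space R w (symbF R w).
Proof.
split=> //; split; last first.
  by apply/polynomial_reciprocity_form; eexists; apply: has_reciprocity_symbF.
by split=> // c h k; rewrite /symbF /= intrM exprMn.
Qed.

Lemma has_reciprocity_symbG : has_reciprocity m (symbG R w) (fun _ => 0).
Proof.
move=> h k; rewrite /symbG /= gcdzN gcdzC subrr /form big1 // => j _.
by rewrite mul0r.
Qed.

Lemma mem_symbG : even_dedekind_space R w (symbG R w).
Proof.
split; last by move=> h k; rewrite /symbG /= gcdzN.
split; last first.
  by apply/polynomial_reciprocity_form; eexists; apply: has_reciprocity_symbG.
split=> [h k|c h k]; rewrite /symbG /=; first by rewrite gcdzDr.
have -> : gcdz (c%:num * h%:num) (c%:num * k) = c%:num * gcdz h%:num k.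
  by rewrite -mulz_gcdr gez0_abs ?ltW ?gt0.
by rewrite intrM exprMn.
Qed.

Lemma bern_pair_refl n : odd n -> (n < w)%N ->
  bern_pair R m n \Po (1 - 'X) = bern_pair R m n.
Proof.
move=> n_odd nw; have n'_odd : odd (w - n) by rewrite oddB ?(ltnW nw) // oddM n_odd.
by rewrite /bern_pair linearD !linearZ /= !bernpoly_refl //= negbK.
Qed.

(** B_l(-x) = B_l(1+x) = B_l(x) + l x^(l-1) for even l. *)
Lemma bern_pair_odd_part n : odd n -> (n < w)%N ->
  bern_pair R m n - (bern_pair R m n \Po (- 'X)) = - ('X^n + 'X^(w - n)).
Proof.
move=> n_odd nw; have n'_odd : odd (w - n) by rewrite oddB ?(ltnW nw) // oddM n_odd.
apply: (@eq_poly_horner_nat _ _ _ 0) => k _; set x : R := k%:R.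
have BN l : odd l -> (bernpoly R l.+1).[- x] = (bernpoly R l.+1).[x] + l.+1%:R * x ^+ l.
  move=> l_odd; rewrite -horner_bernpoly_shift.
  rewrite -(poly_comp_1subX (- x) (bernpoly_refl R (_ : ~~ odd l.+1))) ?opprK 1?addrC //.
  by rewrite /= negbK.
have -> : (- ('X^n + 'X^(w - n))).[x] = - (x ^+ n + x ^+ (w - n)) :> R.
  by rewrite hornerN hornerD !hornerXn.
rewrite hornerD hornerN horner_comp [in LHS]hornerN hornerX.
rewrite /bern_pair !hornerD !hornerZ !BN //.
have e l : l.+1%:R != 0 :> R by rewrite pnatr_eq0.
move: (n.+1%:R) ((w - n).+1%:R) (e n) (e (w - n)%N) => u v u0 v0.
by field; rewrite u0 v0.
Qed.

(** A relation says precisely that p, the combination of the b_n minus the constant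
    e, is palindromic; it is also symmetric under x -> 1 - x, so
    [anharmonic_odd_part_free] applies. *)
Lemma bern_pair_free (ns : seq nat) (c : nat -> R) (e : R) :
  uniq ns -> (forall n, n \in ns -> odd n /\ (n < m)%N) ->
  (2 * size ns < m %/ 3 + m %% 3)%N ->
  (forall j, (j <= w)%N -> \sum_(n <- ns) c n *
     ((bern_pair R m n)`_j - (bern_pair R m n)`_(w - j)) + e * edge j = 0) ->
  forall n, n \in ns -> c n = 0.
Proof.
move=> uns nsP szns cE n0 n0s; have [_ n0m] := nsP _ n0s.
have nsw n : n \in ns -> odd n /\ (n < w)%N by move=> /nsP[? ?]; split=> //; lia.
pose p := \sum_(n <- ns) c n *: bern_pair R m n - e%:P.
have szp : (size p <= w.+1)%N.
  rewrite (leq_trans (size_polyD _ _)) // geq_max size_polyN.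
  rewrite (leq_trans (size_polyC_leq1 _)) // andbT (leq_trans (size_sum _ _ _)) //.
  rewrite big_seq; elim/big_ind: _ => // [x y|n /nsw[n_odd nw]]; first by rewrite geq_max => -> ->.
  by rewrite (leq_trans (size_scale_leq _ _)) // size_bern_pair ?odd_gt0.
have pj j : p`_j = \sum_(n <- ns) c n * (bern_pair R m n)`_j - e * (j == 0)%:R.
  rewrite /p coefB coefC coef_sum; congr (_ - _); last by case: eqP; rewrite ?mulr1 ?mulr0.
  by apply: eq_bigr => n _; rewrite coefZ.
have p_pal j : (j <= w)%N -> p`_j = p`_(w - j).
  move=> lej; apply/eqP; rewrite -subr_eq0; apply/eqP.
  rewrite -[RHS](cE j lej) !pj /edge.
  have -> : (w - j == 0)%N = (j == w) by lia.
  under [in RHS]eq_bigr => n _ do rewrite mulrBr.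
  by rewrite sumrB; ring.
apply/eqP; rewrite -oppr_eq0; apply/eqP.
apply: (@anharmonic_odd_part_free R m p ns (fun n => - c n) uns nsP szns szp _ _ _ n0 n0s).
- rewrite /p linearB linear_sum /= comp_polyC; congr (_ - _).
  rewrite big_seq [RHS]big_seq; apply: eq_bigr => n /nsw[n_odd nw].
  by rewrite linearZ /= bern_pair_refl.
- move=> x x0; rewrite !(horner_coef_wide _ szp) mulr_sumr (reindex_inj rev_ord_inj) /=.
  apply: eq_bigr => j _; rewrite subSS -p_pal ?leq_ord // mulrCA; congr (_ * _).
  by rewrite -{1}(subnKC (leq_ord j)) exprD exprVn mulfK ?expf_neq0.
rewrite /p linearB linear_sum /= comp_polyC opprB addrA subrK -sumrB.
rewrite big_seq [RHS]big_seq; apply: eq_bigr => n /nsw[n_odd nw].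
by rewrite linearZ /= -scalerBr bern_pair_odd_part // scalerN scaleNr.
Qed.
End Members.

(** * The basis *)

Section Basis.
Variable R : realType.
Variable m : nat.
Local Notation w := (2 * m)%N.
Local Notation C := R[i].
Local Notation rc := (real_complex R).

Lemma has_reciprocityD (E E' : symbol R) P P' : has_reciprocity m E P ->
  has_reciprocity m E' P' -> has_reciprocity m (E + E') (fun j => P j + P' j).
Proof.
move=> EP EP' h k; rewrite /form; under eq_bigr => j _ do rewrite mulrDl.
by rewrite big_split /= -!/(form _ _ _ _) -EP -EP' /= opprD addrACA.
Qed.

Lemma has_reciprocityZ (c : C) (E : symbol R) P : has_reciprocity m E P ->
  has_reciprocity m (c *: E) (fun j => c * P j).
Proof.
move=> EP h k; rewrite /form; under eq_bigr => j _ do rewrite -mulrA.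
by rewrite -mulr_sumr -/(form m P _ _) -EP mulrBr.
Qed.

Lemma has_reciprocity_sum r (c : nat -> C) (X : nat -> symbol R) (P : nat -> nat -> C) :
  (forall l, (l < r)%N -> has_reciprocity m (X l) (P l)) ->
  has_reciprocity m (\sum_(l < r) c l *: X l) (fun j => \sum_(l < r) c l * P l j).
Proof.
elim: r => [|r IHr] XP.
  move=> h k; rewrite big_ord0 /form big1 ?subrr // => j _.
  by rewrite big_ord0 mul0r.
have := has_reciprocityD (IHr (fun l ltl => XP l (ltnW ltl))) (has_reciprocityZ (c r) (XP r (ltnSn r))).
move=> H h k; have := H h k; rewrite big_ord_recr /= => ->.
by apply: eq_bigr => j _; rewrite big_ord_recr.
Qed.

Lemma even_dedekind_space0 : even_dedekind_space R w 0.
Proof.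
split=> //; split; first by split=> // c h k; rewrite mulr0.
apply/polynomial_reciprocity_form; exists (fun _ => 0) => h k.
by rewrite /form big1 ?subrr // => j _; rewrite mul0r.
Qed.

Lemma even_dedekind_spaceD E E' : even_dedekind_space R w E ->
  even_dedekind_space R w E' -> even_dedekind_space R w (E + E').
Proof.
move=> [[[per hom] /polynomial_reciprocity_form[P EP]] ev].
move=> [[[per' hom'] /polynomial_reciprocity_form[P' EP']] ev'].
split; [split; [split|]|].
- by move=> h k; rewrite /GRing.add /= -per -per'.
- by move=> c h k; rewrite /GRing.add /= hom hom' mulrDr.
- by apply/polynomial_reciprocity_form; eexists; apply: has_reciprocityD EP EP'.
by move=> h k; rewrite /GRing.add /= ev ev'.
Qed.

Lemma even_dedekind_spaceZ (a : C) E : even_dedekind_space R w E ->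
  even_dedekind_space R w (a *: E).
Proof.
move=> [[[per hom] /polynomial_reciprocity_form[P EP]] ev].
split; [split; [split|]|].
- by move=> h k; rewrite /GRing.scale /= -per.
- by move=> c h k; rewrite /GRing.scale /= hom; exact: mulrCA.
- by apply/polynomial_reciprocity_form; eexists; apply: has_reciprocityZ EP.
by move=> h k; rewrite /GRing.scale /= ev.
Qed.

Lemma sum_complex_real r (z : nat -> C) (f : nat -> R) :
  \sum_(l < r) z l * rc (f l) = 0 ->
  \sum_(l < r) complex.Re (z l) * f l = 0 /\ \sum_(l < r) complex.Im (z l) * f l = 0.
Proof.
have E : \sum_(l < r) z l * rc (f l) =
    Complex (\sum_(l < r) complex.Re (z l) * f l) (\sum_(l < r) complex.Im (z l) * f l).
  elim: r => [|r IHr]; first by rewrite !big_ord0.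
  rewrite !big_ord_recr IHr /=; case: (z r) => a b.
  by apply/eqP; rewrite eq_complex /= !mulr0 subr0 add0r !eqxx.
by rewrite E => /eqP; rewrite eq_complex /= => /andP[/eqP-> /eqP->].
Qed.

Variable ns : seq nat.
Hypotheses (uns : uniq ns) (nsP : forall n, n \in ns -> odd n /\ (n < m)%N).
Hypothesis szns : (size ns).+1 = (uphalf m - m %/ 3)%N.
Hypothesis szns2 : (2 * size ns < m %/ 3 + m %% 3)%N.
Hypothesis m0 : (0 < m)%N.

(** The last index stands for F_w. *)
Definition basis_coef (l : nat) : nat -> R :=
  if (l < size ns)%N then symbE_coef R m (nth 0%N ns l) else edge R m.

(** All multiples of h^w - k^w, those coming from the delta_n included, are
    collected in the constant e of [bern_pair_free]. *)
Lemma basis_coef_free_real (a : nat -> R) :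
  (forall j, (j <= w)%N -> \sum_(l < (size ns).+1) a l * basis_coef l j = 0) ->
  forall l, (l < (size ns).+1)%N -> a l = 0.
Proof.
move=> aE; pose e := \sum_(l < size ns) a l * delta_wn R w (nth 0%N ns l) + a (size ns).
have a0 l : (l < size ns)%N -> a l = 0.
  move=> ltl; have := @bern_pair_free R m ns (fun n => a (index n ns)) e uns nsP szns2.
  move=> /(_ _ (nth 0%N ns l)); rewrite mem_nth // index_uniq //; apply=> // j lej.
  rewrite -[RHS](aE j lej) big_ord_recr /= {2}/basis_coef ltnn.
  rewrite (big_nth 0%N) big_mkord /e mulrDl addrA; congr (_ + _).
  rewrite mulr_suml -big_split /=; apply: eq_bigr => i _.
  by rewrite index_uniq // /basis_coef ltn_ord /symbE_coef; ring.
move=> l; rewrite ltnS leq_eqVlt => /predU1P[->|/a0//].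
have := aE w (leqnn _); rewrite big_ord_recr /= big1 ?add0r => [|i _]; last by rewrite a0 ?mul0r.
rewrite /basis_coef ltnn /edge eqxx; have -> : (w == 0)%N = false by lia.
by rewrite subr0 mulr1.
Qed.

Lemma basis_coef_free (z : nat -> C) :
  (forall j, (j <= w)%N -> \sum_(l < (size ns).+1) z l * rc (basis_coef l j) = 0) ->
  forall l, (l < (size ns).+1)%N -> z l = 0.
Proof.
move=> zE l ltl.
have zE' j lej := @sum_complex_real _ z (fun l => basis_coef l j) (zE j lej).
have re0 := @basis_coef_free_real (fun l => complex.Re (z l)) (fun j lej => (zE' j lej).1) l ltl.
have im0 := @basis_coef_free_real (fun l => complex.Im (z l)) (fun j lej => (zE' j lej).2) l ltl.
by apply/eqP; rewrite eq_complex /= re0 im0 !eqxx.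
Qed.

Definition symbols : seq (symbol R) :=
  [seq symbE R w n | n <- ns] ++ [:: symbF R w; symbG R w].

Lemma size_symbols : size symbols = (size ns).+2.
Proof. by rewrite size_cat size_map addn2. Qed.

Lemma nth_symbolsG : symbols`_(size ns).+1 = symbG R w.
Proof. by rewrite nth_cat size_map ltnNge leqnSn /= subSnn. Qed.

Lemma nsw n : n \in ns -> odd n /\ (n < w)%N.
Proof. by move=> /nsP[? ?]; split=> //; lia. Qed.

Lemma symbols_reciprocity l : (l < (size ns).+1)%N ->
  has_reciprocity m symbols`_l (fun j => rc (basis_coef l j)).
Proof.
rewrite ltnS leq_eqVlt /basis_coef nth_cat size_map => /predU1P[->|ltl].
  by rewrite ltnn subnn; apply: has_reciprocity_symbF.
rewrite ltl (nth_map 0%N) //; have [n_odd nw] := nsw (mem_nth 0%N ltl).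
exact: has_reciprocity_symbE.
Qed.

Lemma mem_symbols l : (l < (size ns).+2)%N -> even_dedekind_space R w symbols`_l.
Proof.
rewrite -size_symbols => ltl; have := mem_nth 0 ltl.
rewrite mem_cat => /orP[/mapP[n /nsw[n_odd nw] ->]|].
  exact: mem_symbE.
rewrite !inE => /orP[/eqP->|/eqP->]; [exact: mem_symbF|exact: mem_symbG].
Qed.

(** A relation between the symbols is one between their reciprocity polynomials,
    which leaves only G_w. Conversely the reciprocity polynomials span the even
    period polynomials, so any symbol differs from a combination of the first
    ones by a symbol without reciprocity polynomial, a multiple of G_w. *)
Lemma symbols_basis : is_basis C (symbol R) (even_dedekind_space R w) symbols.
Proof.
have sumE (c : nat -> C) : \sum_(i < size symbols) c i *: symbols`_i =
    \sum_(l < (size ns).+1) c l *: symbols`_l + c (size ns).+1 *: symbG R w.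
  by rewrite -(big_mkord xpredT (fun i => c i *: symbols`_i)) size_symbols big_mkord
    big_ord_recr /= nth_symbolsG.
have ext (c : 'I_(size symbols) -> C) : exists c' : nat -> C, forall i, c i = c' i.
  by exists (fun i => if insub i is Some j then c j else 0) => i; rewrite valK.
split.
  move=> c0; have [c cE] := ext c0; under eq_bigr do rewrite cE; rewrite sumE => sum0.
  have rec0 := has_reciprocityD (has_reciprocity_sum c symbols_reciprocity)
    (has_reciprocityZ (c (size ns).+1) (has_reciprocity_symbG R m)).
  rewrite sum0 in rec0.
  have c_low l : (l < (size ns).+1)%N -> c l = 0.
    apply: basis_coef_free => j lej; rewrite -[LHS]addr0 -{2}(mulr0 (c (size ns).+1)).
    move: j lej; apply: (form_nat_inj (P' := fun _ => 0)) => -[//|a] _.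
    have := rec0 (posnat a) (posnat 0); rewrite /= subrr => <-.
    by rewrite /form big1 // => j _; rewrite mul0r.
  have c_G : c (size ns).+1 = 0.
    move: sum0; rewrite big1 ?add0r => [|l _]; last by rewrite c_low ?scale0r.
    have G1 : symbG R w (posnat 0, 0) = 1 by apply: (expr1n C w).
    move=> /(congr1 (fun E : symbol R => E (posnat 0, 0))) cG0.
    have : c (size ns).+1 * symbG R w (posnat 0, 0) = 0 := cG0.
    by rewrite G1 mulr1.
  move=> i; rewrite cE; have := ltn_ord i; rewrite {2}size_symbols ltnS leq_eqVlt.
  by case/predU1P => [->|/c_low].
move=> v; split=> [vV|[c0 ->]]; last first.
  apply: (big_ind (even_dedekind_space R w)).
  - exact: even_dedekind_space0.
  - exact: even_dedekind_spaceD.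
  move=> i _; apply/even_dedekind_spaceZ/mem_symbols.
  by rewrite -size_symbols.
have [[_ /polynomial_reciprocity_form[P vP]] _] := vV.
have PW := even_period_of_symbol vV vP.
pose Bs (i : 'I_(size ns).+1) (j : nat) : C := rc (basis_coef i j).
have BsW i : even_period m (Bs i).
  apply: (even_period_of_symbol (mem_symbols (ltnW (ltn_ord i)))).
  exact: symbols_reciprocity.
have Bs_free (c : 'I_(size ns).+1 -> C) :
    (forall j, (j <= w)%N -> \sum_i c i * Bs i j = 0) -> forall i, c i = 0.
  move=> cB i; pose c' l := if insub l is Some j then c j else 0.
  have c'E (l : 'I_(size ns).+1) : c l = c' l by rewrite /c' valK.
  rewrite c'E; apply: basis_coef_free => // j lej.
  transitivity (\sum_i c i * Bs i j); last exact: cB.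
  by apply: eq_bigr => l _; rewrite c'E.
have [c cP] := even_period_span szns BsW Bs_free PW.
pose c' l := if insub l is Some j then c j else 0.
have c'E (l : 'I_(size ns).+1) : c l = c' l by rewrite /c' valK.
pose D := v - \sum_(l < (size ns).+1) c' l *: symbols`_l.
have DV : even_dedekind_space R w D.
  rewrite /D -scaleN1r; apply: even_dedekind_spaceD => //; apply: even_dedekind_spaceZ.
  apply: (big_ind (even_dedekind_space R w)).
  - exact: even_dedekind_space0.
  - exact: even_dedekind_spaceD.
  by move=> i _; apply: even_dedekind_spaceZ; apply: mem_symbols (ltnW (ltn_ord i)).
have D0 (h k : {posnum int}) : D (h, k%:num) = D (k, - h%:num).
  apply/eqP; rewrite -subr_eq0; apply/eqP.
  have := has_reciprocityD vP (has_reciprocityZ (-1) (has_reciprocity_sum c' symbols_reciprocity)).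
  rewrite scaleN1r => /(_ h k) ->; rewrite /form big1 // => j _.
  rewrite (cP j (leq_ord j)); under eq_bigr => l _ do rewrite c'E.
  by rewrite mulN1r subrr mul0r.
have DG := symbG_unique DV.1.1 D0.
pose c'' l := if (l < (size ns).+1)%N then c' l else D (posnat 0, 0).
exists (fun i => c'' i); rewrite sumE {2}/c'' ltnn -DG.
have -> : \sum_(l < (size ns).+1) c'' l *: symbols`_l =
    \sum_(l < (size ns).+1) c' l *: symbols`_l.
  by apply: eq_bigr => l _; rewrite /c'' ltn_ord.
by rewrite addrC subrK.
Qed.
End Basis.

Theorem theorem2p7 (R : realType) (w : nat) (hw0 : (0 < w)%N) (hw : ~~ odd w) :
  is_basis R[i] (symbol R) (even_dedekind_space R w)
    ([seq symbE R w (index4pm1 w i) | i <- iota 1 (dimd w)]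
     ++ [:: symbF R w; symbG R w]).
Proof.
have [m wE] : exists m, w = (2 * m)%N by exists w./2; rewrite mul2n even_halfK.
rewrite (map_comp (symbE R w) (index4pm1 w)).
set ns := [seq index4pm1 w i | i <- iota 1 (dimd w)].
have szns : size ns = dimd w by rewrite size_map size_iota.
have dE := erefl (dimd w); rewrite {2}/dimd in dE.
have uns : uniq ns.
  rewrite map_inj_in_uniq ?iota_uniq // => i j; rewrite !mem_iota /index4pm1.
  by case: ifP; lia.
have nsP (n : nat) : n \in ns -> odd n /\ (n < m)%N.
  move=> /mapP[l]; rewrite mem_iota /index4pm1 => lP ->.
  have [w4|w4] := ifP; move: dE; case: ifP => w12 dE; split; lia.
(* Both uphalf m - m / 3 = d_w + 1 and 2 d_w < m / 3 + m %% 3 are checked on the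
   residue of m modulo 6. *)
rewrite wE; apply: symbols_basis => //; rewrite ?szns; move: dE; case: ifP; lia.
Qed.
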